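(* Let $\mathbf{s}\in\{01,10\}$, and let $\lambda(u)=(\lambda_1(u),\lambda_2(u))$, $\bar\lambda(u)=(\bar\lambda_1(u),\bar\lambda_2(u))$ with $\lambda_i(u)=\sum_{r\ge0}\lambda_i^{(r)}u^{-r}$, $\bar\lambda_i(u)=\sum_{r\ge0}\bar\lambda_i^{(r)}u^r$ having complex coefficients and $\lambda_i^{(0)}\bar\lambda_i^{(0)}=1$. The following conditions for the irreducible highest weight representation $V_{\mathbf{s}}(\lambda(u);\bar\lambda(u))$ of $\mathrm{U}_q(\widehat{\mathfrak{gl}}_{1|1,\mathbf{s}})$ are equivalent: (1) $\dim V_{\mathbf{s}}(\lambda(u);\bar\lambda(u))<\infty$; (2) there exist polynomials $Q(u),\widetilde Q(u)\in\mathbb{C}[u]$ of (the same) degree $K$, for each of which the product of the leading coefficient and the constant term equals $1$, such that $$\frac{\lambda_1(u)}{\lambda_2(u)}=\frac{Q(u)}{\widetilde Q(u)}=\frac{\bar\lambda_1(u)}{\bar\lambda_2(u)},$$ where the first equality is understood in $\mathbb{C}[[u^{-1}]]$ (expansion at $u=\infty$) and the second in $\mathbb{C}[[u]]$ (expansion at $u=0$).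
   Context: $q\in\mathbb{C}\setminus\{0\}$ is not a root of unity. For $\mathbf{s}=s_1s_2\in\{01,10\}$ (so $N=2$): $|i|=\bar0$, $d_i=1$ if $s_i=0$, and $|i|=\bar1$, $d_i=-1$ if $s_i=1$; $q_i=q^{d_i}$; $\varsigma_{ab;cd}=(-1)^{(|a|+|b|)(|c|+|d|)}$; $\delta_{\mathrm{cond}}$ is $1$ if the condition holds and $0$ otherwise. $\mathrm{U}_q(\widehat{\mathfrak{gl}}_{1|1,\mathbf{s}})$ is the associative superalgebra over $\mathbb{C}$ generated by $t_{ij}^{(r)},\bar t_{ij}^{(r)}$ ($1\le i,j\le 2$, $r\in\mathbb{Z}_{\ge0}$), of parity $|i|+|j|$. With $t_{ij}(u)=\sum_{r\ge0}t_{ij}^{(r)}u^{-r}$, $\bar t_{ij}(u)=\sum_{r\ge0}\bar t_{ij}^{(r)}u^r$, the defining relations are: $t_{12}^{(0)}=\bar t_{21}^{(0)}=0$; $t_{ii}^{(0)}\bar t_{ii}^{(0)}=\bar t_{ii}^{(0)}t_{ii}^{(0)}=1$; and, for each of $(\gamma,\gamma')=(t,t),(\bar t,\bar t),(t,\bar t)$ and all $i,j,k,l$, $$(q_i^{-\delta_{ik}}v-q_i^{\delta_{ik}}u)\gamma_{ij}(u)\gamma'_{kl}(v)-\varsigma_{ij;kl}(q_j^{-\delta_{jl}}v-q_j^{\delta_{jl}}u)\gamma'_{kl}(v)\gamma_{ij}(u)$$ $$=\varsigma_{ik;kl}(q_k-q_k^{-1})\Big((\delta_{k<i}u+\delta_{i<k}v)\gamma_{kj}(u)\gamma'_{il}(v)-(\delta_{j<l}u+\delta_{l<j}v)\gamma'_{kj}(v)\gamma_{il}(u)\Big).$$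 $V_{\mathbf{s}}(\lambda(u);\bar\lambda(u))$ is the (unique up to isomorphism) irreducible representation generated by a nonzero vector $\zeta$ with $t_{12}(u)\zeta=\bar t_{12}(u)\zeta=0$, $t_{ii}(u)\zeta=\lambda_i(u)\zeta$, $\bar t_{ii}(u)\zeta=\bar\lambda_i(u)\zeta$ for $i=1,2$. *)

(* Defs.v *)
From HB Require Import structures.
From mathcomp Require Import all_boot all_order all_algebra ring_quotient.
From mathcomp Require Import boolp reals complex.
From mathcomp.multinomials Require Import monalg.

Set Implicit Arguments.
Unset Strict Implicit.
Unset Printing Implicit Defensive.

Import GRing.Theory.
Local Open Scope ring_scope.
Local Open Scope quotient_scope.

(** ** Algebras presented by generators and relations

    [{malg K[{fmonom G}]}] is the free associative unital [K]-algebra on [G]. *)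

Section Presentation.

Variables (K : fieldType) (G : choiceType).

Local Notation F := {malg K[{fmonom G}]}.

Definition freegen (g : G) : F := << fmu g >>.

Lemma malg_scaleAr (a : K) (x y : F) : a *: (x * y) = x * (a *: y).
Proof.
suff h : x * a%:MP = a%:MP * x by rewrite -!mul_malgC mulrA -h -mulrA.
rewrite !malgM_def fgmulgU fgmulUg; apply: eq_bigr => k _.
by rewrite mulrC mulm1 mul1m.
Qed.

Section Quotient.

Variable rel : F -> Prop.

Inductive ideal_of : F -> Prop :=
| ideal_rel x : rel x -> ideal_of x
| ideal_0 : ideal_of 0
| ideal_add x y : ideal_of x -> ideal_of y -> ideal_of (x + y)
| ideal_mull a x : ideal_of x -> ideal_of (a * x)
| ideal_mulr a x : ideal_of x -> ideal_of (x * a).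

Definition in_ideal : {pred F} := fun x => `[< ideal_of x >].

Lemma in_ideal_zmod : zmod_closed in_ideal.
Proof.
split=> [|x y /asboolP hx /asboolP hy]; apply/asboolP; first exact: ideal_0.
by apply: ideal_add hx _; rewrite -mulN1r; exact: ideal_mull.
Qed.

HB.instance Definition _ := GRing.isZmodClosed.Build F in_ideal in_ideal_zmod.

Definition palg : Type := Quotient.quot in_ideal.

HB.instance Definition _ := GRing.Zmodule.on palg.

Definition palg_pi (x : F) : palg := \pi_palg x.

Lemma palg_piP x y : palg_pi x = palg_pi y <-> ideal_of (x - y).
Proof.
rewrite /palg_pi; split.
  move/eqP; rewrite -(Quotient.idealrBE in_ideal).
  by move/asboolP.
by move=> h; apply/eqP; rewrite -(Quotient.idealrBE in_ideal); apply/asboolP.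
Qed.

Lemma palg_piD x y : palg_pi (x + y) = palg_pi x + palg_pi y.
Proof. exact: raddfD. Qed.

Lemma palg_reprK x : palg_pi (repr x) = x.
Proof. exact: reprK. Qed.

Definition palg_one : palg := palg_pi 1.
Definition palg_mul (x y : palg) : palg := palg_pi (repr x * repr y).
Definition palg_scale (a : K) (x : palg) : palg := palg_pi (a *: repr x).

Lemma palg_piM x y : palg_mul (palg_pi x) (palg_pi y) = palg_pi (x * y).
Proof.
apply/palg_piP; set x' := repr _; set y' := repr _.
have hx : ideal_of (x' - x) by apply/palg_piP; rewrite palg_reprK.
have hy : ideal_of (y' - y) by apply/palg_piP; rewrite palg_reprK.
have -> : x' * y' - x * y = (x' - x) * y' + x * (y' - y).
  by rewrite mulrBl mulrBr addrA addrNK.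
by apply: ideal_add; [exact: ideal_mulr | exact: ideal_mull].
Qed.

Lemma palg_piZ a x : palg_scale a (palg_pi x) = palg_pi (a *: x).
Proof.
apply/palg_piP; set x' := repr _; rewrite -scalerBr -mul_malgC.
by apply: ideal_mull; apply/palg_piP; rewrite palg_reprK.
Qed.

Lemma palg_ind (P : palg -> Prop) : (forall x, P (palg_pi x)) -> forall x, P x.
Proof. by move=> h x; rewrite -[x]palg_reprK. Qed.

Lemma palg_mulA : associative palg_mul.
Proof.
by elim/palg_ind=> x; elim/palg_ind=> y; elim/palg_ind=> z;
   rewrite !palg_piM mulrA.
Qed.

Lemma palg_mul1 : left_id palg_one palg_mul.
Proof. by elim/palg_ind=> x; rewrite palg_piM mul1r. Qed.

Lemma palg_1mul : right_id palg_one palg_mul.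
Proof. by elim/palg_ind=> x; rewrite palg_piM mulr1. Qed.

Lemma palg_mulDl : left_distributive palg_mul +%R.
Proof.
by elim/palg_ind=> x; elim/palg_ind=> y; elim/palg_ind=> z;
   rewrite -palg_piD !palg_piM -palg_piD mulrDl.
Qed.

Lemma palg_mulDr : right_distributive palg_mul +%R.
Proof.
by elim/palg_ind=> x; elim/palg_ind=> y; elim/palg_ind=> z;
   rewrite -palg_piD !palg_piM -palg_piD mulrDr.
Qed.

HB.instance Definition _ := GRing.Zmodule_isPzRing.Build palg
  palg_mulA palg_mul1 palg_1mul palg_mulDl palg_mulDr.

Lemma palg_scaleA a b x : palg_scale a (palg_scale b x) = palg_scale (a * b) x.
Proof. by elim/palg_ind: x => x; rewrite !palg_piZ scalerA. Qed.

Lemma palg_scale1 : left_id 1 palg_scale.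
Proof. by elim/palg_ind=> x; rewrite palg_piZ scale1r. Qed.

Lemma palg_scaleDr : right_distributive palg_scale +%R.
Proof.
move=> a; elim/palg_ind=> x; elim/palg_ind=> y.
by rewrite -palg_piD !palg_piZ -palg_piD scalerDr.
Qed.

Lemma palg_scaleDl x : {morph palg_scale^~ x : a b / a + b}.
Proof. by elim/palg_ind: x => x a b; rewrite !palg_piZ -palg_piD scalerDl. Qed.

HB.instance Definition _ := GRing.Zmodule_isLmodule.Build K palg
  palg_scaleA palg_scale1 palg_scaleDr palg_scaleDl.

Lemma palg_scaleAl (a : K) (x y : palg) : a *: (x * y) = a *: x * y.
Proof.
elim/palg_ind: x => x; elim/palg_ind: y => y.
rewrite /GRing.scale /GRing.mul /= !(palg_piM, palg_piZ).
by rewrite -scalerAl.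
Qed.

Lemma palg_scaleAr (a : K) (x y : palg) : a *: (x * y) = x * (a *: y).
Proof.
elim/palg_ind: x => x; elim/palg_ind: y => y.
rewrite /GRing.scale /GRing.mul /= !(palg_piM, palg_piZ); congr palg_pi.
exact: malg_scaleAr.
Qed.

End Quotient.

(** The superalgebra structure: the generator [g] has parity [par g]. *)

Variables (par : G -> bool) (rel : F -> Prop).

Definition word_parity (m : {fmonom G}) : bool := odd (count par m).

Definition palg_homog (p : bool) (x : palg rel) : Prop :=
  exists2 f : F, x = palg_pi rel f & forall m, f@_m != 0 -> word_parity m = p.

(** In a super vector space [V0 * V1], [V0] is the even part and [V1] the
    odd part. *)

Definition homog (V0 V1 : lmodType K) (p : bool) (v : V0 * V1) : Prop :=
  if p then v.1 = 0 else v.2 = 0.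

Record superrep := Superrep {
  rep_even : lmodType K;
  rep_odd : lmodType K;
  act : palg rel -> rep_even * rep_odd -> rep_even * rep_odd;
  act_linearl : forall v, linear (act^~ v);
  act_linearr : forall x, linear (act x);
  act1 : forall v, act 1 v = v;
  actM : forall x y v, act (x * y) v = act x (act y v);
  act_homog : forall p p' x v,
    palg_homog p x -> homog p' v -> homog (p (+) p') (act x v)
}.

Definition rep_space (V : superrep) : lmodType K :=
  (rep_even V * rep_odd V)%type.

Coercion rep_space : superrep >-> GRing.Lmodule.type.

Definition is_subrep (V : superrep) (W : V -> Prop) : Prop :=
  [/\ W 0,
      forall (a : K) v w, W v -> W w -> W (a *: v + w),
      forall x v, W v -> W (act x v)
    & forall v : V, W v -> W (v.1, 0) /\ W (0, v.2)].

Definition irreducible (V : superrep) : Prop :=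
  (exists v : V, v != 0) /\
  forall W : V -> Prop, is_subrep W ->
    (forall v, W v -> v = 0) \/ (forall v, W v).

Definition generated_by (V : superrep) (z : V) : Prop :=
  forall v : V, exists x, v = act x z.

End Presentation.

Definition finite_dim (K : fieldType) (V : lmodType K) : Prop :=
  exists n (e : 'I_n -> V), forall v, exists c : 'I_n -> K,
    v = \sum_(i < n) c i *: e i.

(** ** The quantum affine superalgebra [U_q(gl_{1|1,s}^)]

    The indices 1 and 2 are [idx1] and [idx2] in ['I_2]. *)

Notation idx1 := (ord0 : 'I_2).
Notation idx2 := (ord_max : 'I_2).

(** [(b, i, j, r)] stands for [t_ij^(r)] if [b = false] and for
    [\bar t_ij^(r)] if [b = true]. *)
Definition Ugen : choiceType := (bool * 'I_2 * 'I_2 * nat)%type.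

Section QuantumAffine.

Variables (K : fieldType) (q : K) (s : 2.-tuple bool).

Definition ipar (i : 'I_2) : bool := tnth s i.
Definition qi (i : 'I_2) : K := q ^ (if ipar i then -1 else 1).

Definition ssign (a b c d : 'I_2) : K :=
  (-1) ^+ ((ipar a (+) ipar b) && (ipar c (+) ipar d)).

Definition Upar (g : Ugen) : bool :=
  let: (_, i, j, _) := g in ipar i (+) ipar j.

Local Notation F := {malg K[{fmonom Ugen}]}.

Definition fgen (b : bool) (i j : 'I_2) (r : nat) : F :=
  freegen K ((b, i, j, r) : Ugen).

(** The coefficient of [u^m] in [t_ij(u)], a series in [u^-1], resp. in
    [\bar t_ij(u)], a series in [u]. *)
Definition tcoef (b : bool) (i j : 'I_2) (m : int) : F :=
  if (if b then 0 <= m else m <= 0) then fgen b i j `|m|%N else 0.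

(** A two-sided formal series in [u] and [v]: [f m n] is the coefficient of
    [u^m v^n]. *)
Definition fser := int -> int -> F.
Definition mulu (f : fser) : fser := fun m n => f (m - 1) n.
Definition mulv (f : fser) : fser := fun m n => f m (n - 1).

(** [tuv b i j b' k l] is [gamma_ij(u) gamma'_kl(v)] and [tvu b' k l b i j] is
    [gamma'_kl(v) gamma_ij(u)]. *)
Definition tuv b i j b' k l : fser := fun m n => tcoef b i j m * tcoef b' k l n.
Definition tvu b' k l b i j : fser := fun m n => tcoef b' k l n * tcoef b i j m.

Definition rtt_lhs (b b' : bool) (i j k l : 'I_2) : fser := fun m n =>
  (qi i ^- (i == k) *: mulv (tuv b i j b' k l) m n
     - qi i ^+ (i == k) *: mulu (tuv b i j b' k l) m n)
  - ssign i j k l *: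
    (qi j ^- (j == l) *: mulv (tvu b' k l b i j) m n
     - qi j ^+ (j == l) *: mulu (tvu b' k l b i j) m n).

Definition rtt_rhs (b b' : bool) (i j k l : 'I_2) : fser := fun m n =>
  (ssign i k k l * (qi k - (qi k)^-1)) *:
  (((k < i)%N%:R *: mulu (tuv b k j b' i l) m n
      + (i < k)%N%:R *: mulv (tuv b k j b' i l) m n)
   - ((j < l)%N%:R *: mulu (tvu b' k j b i l) m n
      + (l < j)%N%:R *: mulv (tvu b' k j b i l) m n)).

Inductive Urel : F -> Prop :=
| Urel_t12 : Urel (fgen false idx1 idx2 0)
| Urel_tb21 : Urel (fgen true idx2 idx1 0)
| Urel_ttb i : Urel (fgen false i i 0 * fgen true i i 0 - 1)
| Urel_tbt i : Urel (fgen true i i 0 * fgen false i i 0 - 1)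
| Urel_rtt b b' i j k l m n :
    (b, b') \in [:: (false, false); (true, true); (false, true)] ->
    Urel (rtt_lhs b b' i j k l m n - rtt_rhs b b' i j k l m n).

Definition Uq := palg Urel.

Definition tgen (b : bool) (i j : 'I_2) (r : nat) : Uq :=
  palg_pi Urel (fgen b i j r).

Definition Urep := superrep Upar Urel.

Definition highest_weight_vector (V : Urep) (lam lamb : 'I_2 -> nat -> K)
    (z : V) : Prop :=
  [/\ z != 0,
      forall r, act (tgen false idx1 idx2 r) z = 0,
      forall r, act (tgen true idx1 idx2 r) z = 0,
      forall i r, act (tgen false i i r) z = lam i r *: z
    & forall i r, act (tgen true i i r) z = lamb i r *: z].

(** Characterizes [V_s(lambda(u); \bar lambda(u))] up to isomorphism. *)
Definition irreducible_highest_weight (V : Urep)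
    (lam lamb : 'I_2 -> nat -> K) : Prop :=
  irreducible V /\
  exists z : V, highest_weight_vector lam lamb z /\ generated_by z.

End QuantumAffine.

(** ** Formal power series in one variable, as sequences of coefficients *)

Section PowerSeries.

Variable K : fieldType.

Definition fps_mul (a b : nat -> K) : nat -> K :=
  fun n => \sum_(i < n.+1) a i * b (n - i)%N.

(** The first [n] coefficients of the inverse of [a], when [a 0 != 0]. *)
Fixpoint fps_inv_seq (a : nat -> K) (n : nat) : seq K :=
  if n is n'.+1 then
    let c := fps_inv_seq a n' in
    rcons c ((a 0%N)^-1 *
      ((n' == 0%N)%:R - \sum_(i < n') a i.+1 * c`_(n' - i.+1)))
  else [::].

Definition fps_inv (a : nat -> K) : nat -> K := fun n => (fps_inv_seq a n.+1)`_n.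

Definition fps_div (a b : nat -> K) : nat -> K := fps_mul a (fps_inv b).

Lemma size_fps_inv_seq a n : size (fps_inv_seq a n) = n.
Proof. by elim: n => //= n IHn; rewrite size_rcons IHn. Qed.

Lemma nth_fps_inv_seq a n i : (i < n)%N -> (fps_inv_seq a n)`_i = fps_inv a i.
Proof.
elim: n => // n IHn; rewrite ltnS leq_eqVlt => /orP[/eqP -> //|lt_in].
by rewrite /= nth_rcons size_fps_inv_seq lt_in IHn.
Qed.

Lemma fps_mulV a : a 0%N != 0 -> fps_mul a (fps_inv a) =1 (fun n => (n == 0%N)%:R).
Proof.
move=> a0 n; rewrite /fps_mul big_ord_recl subn0 {1}/fps_inv /=.
rewrite nth_rcons size_fps_inv_seq ltnn eqxx mulrA divff // mul1r.
rewrite (eq_bigr (fun i : 'I_n => a i.+1 * fps_inv a (n - i.+1))) ?subrK //.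
by move=> i _; rewrite nth_fps_inv_seq // subnSK ?leq_subr.
Qed.

(** The coefficients of [P] at [u = 0], and those of [u^-k P(u)] as a series
    in [u^-1] when [deg P <= k]; the common factor [u^-k] cancels in the
    quotient of two polynomials of degree [k]. *)
Definition fps_at0 (P : {poly K}) : nat -> K := fun r => P`_r.
Definition fps_atoo (k : nat) (P : {poly K}) : nat -> K :=
  fun r => if (r <= k)%N then P`_(k - r) else 0.

End PowerSeries.

(* Main.v *)
Require Import Defs.
From HB Require Import structures.
From mathcomp Require Import all_boot all_order all_algebra.
From mathcomp Require Import reals complex.
From mathcomp.multinomials Require Import monalg.
From mathcomp Require Import ring zify.

(** Write [p = q_1], so that [q_2 = p^-1], and rescale [t(u)] and [\bar t(u)]
    by scalar series, which preserves the defining relations.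

    (2) => (1): after rescaling, [zeta] has weights [u^-K Q, u^-K Qt] for [t]
    and [Q, Qt] for [\bar t]. The series [D_ij(u) = u^K t_ij(u) - \bar t_ij(u)]
    still satisfy the relations against [t] and [\bar t], and kill [zeta]:
    [D_21 zeta] is singular of weight [p lambda_1], hence zero by
    irreducibility. The space killed by all the [D_ij] is stable, so [D = 0],
    and [t_21(u)] is a polynomial in [u^-1] with coefficients [x_0, ..., x_K]
    whose words span [V] when applied to [zeta]. The relation between [x_r] and
    [x_s] rewrites every word into strictly increasing ones, of length at most
    [K + 1].

    (1) => (2): after rescaling, the weights are [(c, 1)] and [(cb, 1)] where
    [c = lambda_1 / lambda_2] and similarly for [cb]. A linear dependence between
    the coefficients of [(t_21 - \bar t_21) zeta], paired with [t_12] and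
    [\bar t_12], is a polynomial [A] with [A (c - cb) = 0] as a two-sided series,
    so that [A c = A cb] is a polynomial. *)

Set Implicit Arguments.
Unset Strict Implicit.
Unset Printing Implicit Defensive.
Import Order.TTheory GRing.Theory.
Local Open Scope ring_scope.

(** * Identities in modules *)

(* The square-zero extension of [K] by [V] is a commutative ring, so that the
   tactic [ring] proves identities in [V]. *)
Section Triv.
Variables (K : fieldType) (V : lmodType K).

Definition triv_ext : Type := (K * V)%type.
HB.instance Definition _ := GRing.Zmodule.on triv_ext.

Definition triv_one : triv_ext := (1, 0).
Definition triv_mul (x y : triv_ext) : triv_ext :=
  (x.1 * y.1, x.1 *: y.2 + y.1 *: x.2).

Fact triv_mulA : associative triv_mul.
Proof.
move=> [a u] [b v] [c w]; rewrite /triv_mul /= mulrA !scalerDr !scalerA addrA.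
by rewrite (mulrC c a) (mulrC c b).
Qed.
Fact triv_mulC : commutative triv_mul.
Proof. by move=> [a u] [b v]; rewrite /triv_mul /= mulrC addrC. Qed.
Fact triv_mul1 : left_id triv_one triv_mul.
Proof. by move=> [a u]; rewrite /triv_mul /= mul1r scale1r scaler0 addr0. Qed.
Fact triv_mulDl : left_distributive triv_mul +%R.
Proof.
move=> [a u] [b v] [c w]; rewrite /triv_mul /=; congr pair => /=.
  by rewrite mulrDl.
by rewrite scalerDl scalerDr addrACA.
Qed.
Fact triv_1neq0 : triv_one != 0.
Proof. by rewrite xpair_eqE oner_eq0. Qed.
HB.instance Definition _ := GRing.Zmodule_isComNzRing.Build triv_ext
  triv_mulA triv_mulC triv_mul1 triv_mulDl triv_1neq0.

Definition triv_vec (v : V) : triv_ext := (0, v).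
Definition triv_scal (a : K) : triv_ext := (a, 0).

Fact triv_scal_zmod : zmod_morphism triv_scal.
Proof. by move=> a b; congr pair; rewrite subr0. Qed.
HB.instance Definition _ := GRing.isZmodMorphism.Build K triv_ext triv_scal
  triv_scal_zmod.
Fact triv_scal_monoid : monoid_morphism triv_scal.
Proof. by split=> // a b; congr pair; rewrite /= !scaler0 addr0. Qed.
HB.instance Definition _ := GRing.isMonoidMorphism.Build K triv_ext triv_scal
  triv_scal_monoid.

Lemma triv_vec_inj : injective triv_vec.
Proof. by move=> u v [->]. Qed.
Lemma triv_vec0 : triv_vec 0 = 0. Proof. by []. Qed.
Lemma triv_vecD u v : triv_vec (u + v) = triv_vec u + triv_vec v.
Proof. by congr pair; rewrite /= addr0. Qed.
Lemma triv_vecN v : triv_vec (- v) = - triv_vec v.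
Proof. by congr pair; rewrite /= oppr0. Qed.
Lemma triv_vecZ a v : triv_vec (a *: v) = triv_scal a * triv_vec v.
Proof. by congr pair; rewrite /= ?mulr0 // scale0r addr0. Qed.

Definition triv_vecE := (triv_vecD, triv_vecN, triv_vec0, triv_vecZ).

End Triv.

Ltac module_simpl := apply: triv_vec_inj; rewrite !triv_vecE.


(** * Subspaces and two-sided series *)

Section Subspaces.
Variables (K : fieldType) (V : lmodType K).

(** This reduces a goal that follows from a known relation to a linear identity, which
    [module_simpl] hands over to [ring]. *)
Lemma lin_from (c : K) (L R X Y : V) : L = R -> X - Y = c *: (L - R) -> X = Y.
Proof. by move=> ->; rewrite subrr scaler0 => /eqP; rewrite subr_eq0 => /eqP. Qed.

Definition subsp (S : V -> Prop) :=
  S 0 /\ forall (a : K) v w, S v -> S w -> S (a *: v + w).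

Section Closure.
Variables (S : V -> Prop) (hS : subsp S).
Lemma subspD v w : S v -> S w -> S (v + w).
Proof. by move=> hv hw; rewrite -[v]scale1r; apply: hS.2. Qed.
Lemma subspZ a v : S v -> S (a *: v).
Proof. by move=> hv; rewrite -[_ *: _]addr0; apply: hS.2 hv hS.1. Qed.
Lemma subspN v : S v -> S (- v).
Proof. by move=> hv; rewrite -scaleN1r; apply: subspZ. Qed.
Lemma subspB v w : S v -> S w -> S (v - w).
Proof. by move=> hv hw; apply: subspD => //; apply: subspN. Qed.
Lemma subspZE a v : a != 0 -> S (a *: v) -> S v.
Proof. by move=> a0 /(subspZ a^-1); rewrite scalerA mulVf // scale1r. Qed.
Lemma subsp_sum (I : Type) (r : seq I) (P : pred I) F :
  (forall i, P i -> S (F i)) -> S (\sum_(i <- r | P i) F i).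
Proof.
by move=> h; apply: (big_ind S hS.1 _ h) => v w hv hw; exact: subspD.
Qed.
End Closure.

(** The impredicative form makes inclusions easy: it is enough to name a target subspace and check
    it on [P]. *)
Definition span (P : V -> Prop) (v : V) :=
  forall S, subsp S -> (forall w, P w -> S w) -> S v.
Lemma subsp_span P : subsp (span P).
Proof.
split=> [S hS _|a v w hv hw S hS h]; first exact: hS.1.
by apply: hS.2; [exact: hv | exact: hw].
Qed.
Lemma span_mem (P : V -> Prop) v : P v -> span P v.
Proof. by move=> hv S _; apply. Qed.
Lemma span_sub (P S : V -> Prop) :
  subsp S -> (forall w, P w -> S w) -> forall v, span P v -> S v.
Proof. by move=> hS h v; apply. Qed.

Lemma subsp0 : subsp (fun v => v = 0).
Proof. by split=> // a v w -> ->; rewrite scaler0 addr0. Qed.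

Section LinearMap.
Variables (f : V -> V) (hf : linear f).
Lemma lin0 : f 0 = 0.
Proof.
have := hf 1 0 0; rewrite scaler0 addr0 scale1r => e.
by apply: (@addrI _ (f 0)); rewrite addr0 -e.
Qed.
Lemma linD v w : f (v + w) = f v + f w.
Proof. by have := hf 1 v w; rewrite !scale1r. Qed.
Lemma linZ a v : f (a *: v) = a *: f v.
Proof. by have := hf a v 0; rewrite lin0 !addr0. Qed.
Lemma linN v : f (- v) = - f v.
Proof. by rewrite -!scaleN1r linZ. Qed.
Lemma linB v w : f (v - w) = f v - f w.
Proof. by rewrite linD linN. Qed.
Lemma lin_sum (I : Type) (r : seq I) (F : I -> V) :
  f (\sum_(i <- r) F i) = \sum_(i <- r) f (F i).
Proof. by apply: big_morph; [exact: linD | exact: lin0]. Qed.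
End LinearMap.

Lemma subsp_preim (f : V -> V) S : linear f -> subsp S -> subsp (fun v => S (f v)).
Proof.
move=> hf hS; split=> [|a v w hv hw]; last by rewrite hf; apply: hS.2.
by rewrite (lin0 hf); exact: hS.1.
Qed.


(* [X m n] is the coefficient of [u^m v^n] in a two-sided series, and the
   hypothesis says that [(a v - b u) X] vanishes modulo [S]. *)
Lemma two_sided_v S (X : int -> int -> V) (a b : K) : subsp S -> a != 0 -> b != 0 ->
  (forall m n, S (a *: X m (n - 1) - b *: X (m - 1) n)) ->
  (exists N, forall m, S (X m N)) -> forall m n, S (X m n).
Proof.
move=> hS a0 b0 h [N hN].
have up k m : S (X m (N + Posz k)).
  elim: k m => [|k IH] m; first by rewrite addr0.
  apply: (subspZE hS b0).
  have e : N + Posz k.+1 - 1 = N + Posz k by lia.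
  have := h (m + 1) (N + Posz k.+1); rewrite e addrK => /(subspB hS) h1.
  have /h1 := subspZ hS a (IH (m + 1)).
  by rewrite addrAC subrr add0r => /(subspN hS); rewrite opprK.
have dn k m : S (X m (N - Posz k)).
  elim: k m => [|k IH] m; first by rewrite subr0.
  apply: (subspZE hS a0).
  have e : N - Posz k - 1 = N - Posz k.+1 by lia.
  have := h m (N - Posz k); rewrite e => /(subspD hS) h1.
  have /h1 := subspZ hS b (IH (m - 1)).
  by rewrite subrK.
move=> m n; case: (leP N n) => hn.
  have -> : n = N + Posz `|n - N|%N by lia.
  exact: up.
have -> : n = N - Posz `|n - N|%N by lia.
exact: dn.
Qed.

(** Exchanging u and v turns a vanishing column into a vanishing row and the pair (a, b) into (-b,
    -a). *)
Lemma two_sided S (X : int -> int -> V) (a b : K) : subsp S -> a != 0 -> b != 0 ->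
  (forall m n, S (a *: X m (n - 1) - b *: X (m - 1) n)) ->
  (exists N, forall m, S (X m N)) \/ (exists M, forall n, S (X M n)) ->
  forall m n, S (X m n).
Proof.
move=> hS a0 b0 h [|hM m n]; first exact: two_sided_v h.
apply: (@two_sided_v S (fun i j => X j i) (- b) (- a)) => //; rewrite ?oppr_eq0 //.
by move=> i j; rewrite !scaleNr opprK addrC; exact: h.
Qed.

(** Two consecutive rows or columns are needed because the series [Z] in [cross_eq0] mixes
    neighbouring exponents of [X]. *)
Definition one_sided (X : int -> int -> V) :=
  (exists N, forall m, X m N = 0 /\ X m (N + 1) = 0) \/
  (exists M, forall n, X M n = 0 /\ X (M + 1) n = 0).

(* Eliminating [Y] gives [(v - p^2 u)(v - p^-2 u) X = 0]. *)
Lemma cross_eq0 (p p' c c' : K) (X Y : int -> int -> V) :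
  p * p' = 1 -> c * c' = (p - p') ^+ 2 -> p != p' ->
  (forall m n, X m (n - 1) - X (m - 1) n = c *: Y m (n - 1)) ->
  (forall m n, Y m (n - 1) - Y (m - 1) n = c' *: X (m - 1) n) ->
  one_sided X -> forall m n, X m n = 0 /\ Y m n = 0.
Proof.
move=> pp' cc' pnp' hX hY os.
have p0 : p != 0 by apply/eqP => e; move: pp'; rewrite e mul0r => /eqP; rewrite eq_sym oner_eq0.
have p'0 : p' != 0 by apply/eqP => e; move: pp'; rewrite e mulr0 => /eqP; rewrite eq_sym oner_eq0.
have c0 : c != 0.
  apply/eqP => e; move/eqP: cc'; rewrite e mul0r eq_sym expf_eq0 /= subr_eq0.
  by rewrite (negbTE pnp').
(* [Z] is v^-1 (v - p^2 u) X. The first application of [two_sided] uses (v - p^-2 u) Z = 0, the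
   second uses (v - p^2 u) X = 0. *)
pose Z m n := X m n - p ^+ 2 *: X (m - 1) (n + 1).
have Z0 : forall m n, Z m n = 0.
  apply: (@two_sided _ Z 1 (p' ^+ 2) subsp0); rewrite ?oner_eq0 ?expf_neq0 //.
    move=> m n; rewrite /Z subrK.
    have e1 := hX m n.
    have := hX (m - 1) (n + 1); rewrite addrK => e2.
    have e3 := hY m n.
    apply: (lin_from (c := c) e3).
    have hp : triv_scal V p * triv_scal V p' = 1 by rewrite -rmorphM pp' rmorph1.
    have e4 : c *: (c' *: X (m - 1) n) = (p - p') ^+ 2 *: X (m - 1) n by rewrite scalerA cc'.
    rewrite !scalerBr e4 -e1 -e2; module_simpl.
    ring: hp.
  case: os => [[N h]|[M h]]; [left; exists N => m | right; exists (M + 1) => n].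
    by rewrite /Z (h m).1 (h (m - 1)).2 scaler0 subr0.
  by rewrite /Z addrK (h n).2 (h (n + 1)).1 scaler0 subr0.
have X0 : forall m n, X m n = 0.
  apply: (@two_sided _ X 1 (p ^+ 2) subsp0); rewrite ?oner_eq0 ?expf_neq0 //.
    by move=> m n; have := Z0 m (n - 1); rewrite /Z subrK scale1r.
  case: os => [[N h]|[M h]]; [left; exists N => m | right; exists M => n].
    exact: (h m).1.
  exact: (h n).1.
move=> m n; split=> //.
have := hX m (n + 1); rewrite addrK !X0 subrr => /esym/eqP.
by rewrite scaler_eq0 (negbTE c0) => /eqP.
Qed.

End Subspaces.

(** * The defining relations *)

Section RTT.
Variables (K : fieldType) (V : lmodType K) (p p' : K).

(** A 2 by 2 matrix of two-sided operator series: [A i j m w] is the coefficient of u^m in A_ij(u)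
    w. Exponents range over all integers, so that shifts need no boundary cases. *)
Definition opser := bool -> bool -> int -> V -> V.

Definition qq (i : bool) := if i then p' else p.
Definition qv (i : bool) := if i then p else p'.
Definition sg (i j k l : bool) : K := if (i (+) j) && (k (+) l) then -1 else 1.
Definition oif (b : bool) (a : K) := if b then a else 1.
Definition vif (b : bool) (v : V) := if b then v else 0.

(* The index [1] is [false] and the index [2] is [true]; [p = q_1] and
   [p' = q_2 = q_1^-1]. *)
Definition Rel (A B : opser) := forall i j k l (m n : int) w,
  (oif (i == k) (qv i) *: A i j m (B k l (n - 1) w)
     - oif (i == k) (qq i) *: A i j (m - 1) (B k l n w))
  - sg i j k l *:
    (oif (j == l) (qv j) *: B k l (n - 1) (A i j m w)
       - oif (j == l) (qq j) *: B k l n (A i j (m - 1) w))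
  = (sg i k k l * (qq k - qv k)) *:
    ((vif (~~ k && i) (A k j (m - 1) (B i l n w))
        + vif (~~ i && k) (A k j m (B i l (n - 1) w)))
     - (vif (~~ j && l) (B k j n (A i l (m - 1) w))
        + vif (~~ l && j) (B k j (n - 1) (A i l m w)))).

Definition lin_ser (A : opser) := forall i j m, linear (A i j m).

(** Here [c] is the sign by which the general relation is multiplied. The instances keep factors
    [1 *:] on the left so that they have the shape expected by [two_sided]. *)
Ltac from_rel h i j k l c :=
  let e := fresh in have e := h i j k l;
  rewrite /oif /vif /sg /qq /qv /= in e;
  apply: (lin_from (c := c) (e _ _ _)); module_simpl; ring.

Section Instances.
Variables (A B : opser) (h : Rel A B) (m n : int) (w : V).
Notation A11 := (A false false). Notation A12 := (A false true).
Notation A21 := (A true false). Notation A22 := (A true true).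
Notation B11 := (B false false). Notation B12 := (B false true).
Notation B21 := (B true false). Notation B22 := (B true true).

(* [relijkl] is the relation with indices [i], [j], [k], [l]. *)
Lemma rel1121 :
  1 *: A11 m (B21 (n - 1) w) - 1 *: A11 (m - 1) (B21 n w)
  = p' *: B21 (n - 1) (A11 m w) - p *: B21 n (A11 (m - 1) w)
    + (p - p') *: A21 m (B11 (n - 1) w).
Proof. from_rel h false false true false (1 : K). Qed.

Lemma rel2111 :
  p' *: B11 (n - 1) (A21 m w) - p *: B11 n (A21 (m - 1) w)
  = A21 m (B11 (n - 1) w) - A21 (m - 1) (B11 n w)
    - (p - p') *: A11 (m - 1) (B21 n w).
Proof. from_rel h true false false false (-1 : K). Qed.

Lemma rel2122 :
  1 *: B22 (n - 1) (A21 m w) - 1 *: B22 n (A21 (m - 1) w)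
  = p *: A21 m (B22 (n - 1) w) - p' *: A21 (m - 1) (B22 n w)
    - (p - p') *: B21 n (A22 (m - 1) w).
Proof. from_rel h true false true true (-1 : K). Qed.

Lemma rel2221 :
  p *: A22 m (B21 (n - 1) w) - p' *: A22 (m - 1) (B21 n w)
  = B21 (n - 1) (A22 m w) - B21 n (A22 (m - 1) w)
    + (p - p') *: B22 (n - 1) (A21 m w).
Proof. from_rel h true true true false (1 : K). Qed.

Lemma rel1221 :
  1 *: A12 m (B21 (n - 1) w) - 1 *: A12 (m - 1) (B21 n w)
  = - (B21 (n - 1) (A12 m w) - B21 n (A12 (m - 1) w))
    + (p - p') *: (A22 m (B11 (n - 1) w) - B22 (n - 1) (A11 m w)).
Proof. from_rel h false true true false (1 : K). Qed.

Lemma rel2112 :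
  1 *: B12 (n - 1) (A21 m w) - 1 *: B12 n (A21 (m - 1) w)
  = - (A21 m (B12 (n - 1) w) - A21 (m - 1) (B12 n w))
    - (p - p') *: (A11 (m - 1) (B22 n w) - B11 n (A22 (m - 1) w)).
Proof. from_rel h true false false true (1 : K). Qed.

Lemma rel1112 :
  1 *: B12 (n - 1) (A11 m w) - 1 *: B12 n (A11 (m - 1) w)
  = p' *: A11 m (B12 (n - 1) w) - p *: A11 (m - 1) (B12 n w)
    + (p - p') *: B11 n (A12 (m - 1) w).
Proof. from_rel h false false false true (-1 : K). Qed.

Lemma rel1211 :
  p' *: A12 m (B11 (n - 1) w) - p *: A12 (m - 1) (B11 n w)
  = B11 (n - 1) (A12 m w) - B11 n (A12 (m - 1) w)
    - (p - p') *: B12 (n - 1) (A11 m w).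
Proof. from_rel h false true false false (1 : K). Qed.

Lemma rel1222 :
  1 *: A12 m (B22 (n - 1) w) - 1 *: A12 (m - 1) (B22 n w)
  = p *: B22 (n - 1) (A12 m w) - p' *: B22 n (A12 (m - 1) w)
    - (p - p') *: A22 m (B12 (n - 1) w).
Proof. from_rel h false true true true (1 : K). Qed.

Lemma rel2212 :
  p *: B12 (n - 1) (A22 m w) - p' *: B12 n (A22 (m - 1) w)
  = A22 m (B12 (n - 1) w) - A22 (m - 1) (B12 n w)
    + (p - p') *: A12 (m - 1) (B22 n w).
Proof. from_rel h true true false true (-1 : K). Qed.

Lemma rel1111 :
  p' *: A11 m (B11 (n - 1) w) - p *: A11 (m - 1) (B11 n w)
  = p' *: B11 (n - 1) (A11 m w) - p *: B11 n (A11 (m - 1) w).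
Proof. from_rel h false false false false (1 : K). Qed.

Lemma rel1122 :
  1 *: A11 m (B22 (n - 1) w) - 1 *: A11 (m - 1) (B22 n w)
  = B22 (n - 1) (A11 m w) - B22 n (A11 (m - 1) w)
    - (p - p') *: (A21 m (B12 (n - 1) w) - B21 n (A12 (m - 1) w)).
Proof. from_rel h false false true true (1 : K). Qed.

Lemma rel2121 :
  p *: A21 m (B21 (n - 1) w) - p' *: A21 (m - 1) (B21 n w)
  = p *: B21 n (A21 (m - 1) w) - p' *: B21 (n - 1) (A21 m w).
Proof. from_rel h true false true false (1 : K). Qed.

End Instances.

Section Linearity.
Variables (A A' B B' : opser) (hA : lin_ser A) (hB : lin_ser B).

(** The relation is linear in A(u), and shifting its exponents by [r] multiplies it by u^-r, which
    commutes with all the coefficients. *)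
Lemma rel_linl (a : K) (r : int) : Rel A B -> Rel A' B ->
  Rel (fun i j m w => a *: A i j (m + r) w + A' i j m w) B.
Proof.
move=> h h' i j k l m n w.
move: (h i j k l (m + r) n w) (h' i j k l m n w).
rewrite -!(addrAC m (-1)) !(linD (@hB _ _ _)) !(linZ (@hB _ _ _)) => e e'.
rewrite /vif in e e' *.
apply: (lin_from (c := 1) (congr2 (fun x y => a *: x + y) e e')).
by move: (sg i j k l) (sg i k k l * _) (oif _ _) (oif _ _) (oif _ _) (oif _ _)
   => *; case: ifP => _; case: ifP => _; case: ifP => _; case: ifP => _;
   module_simpl; ring.
Qed.

Lemma rel_linr (a : K) (r : int) : Rel A B -> Rel A B' ->
  Rel A (fun i j m w => a *: B i j (m + r) w + B' i j m w).
Proof.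
move=> h h' i j k l m n w.
move: (h i j k l m (n + r) w) (h' i j k l m n w).
rewrite -!(addrAC n (-1)) !(linD (@hA _ _ _)) !(linZ (@hA _ _ _)) => e e'.
rewrite /vif in e e' *.
apply: (lin_from (c := 1) (congr2 (fun x y => a *: x + y) e e')).
by move: (sg i j k l) (sg i k k l * _) (oif _ _) (oif _ _) (oif _ _) (oif _ _)
   => *; case: ifP => _; case: ifP => _; case: ifP => _; case: ifP => _;
   module_simpl; ring.
Qed.

End Linearity.

Lemma rel_zerol (B : opser) : lin_ser B -> Rel (fun _ _ _ _ => 0) B.
Proof.
move=> hB i j k l m n w.
by rewrite !(lin0 (@hB _ _ _)) /vif !if_same !(scaler0, subrr, addr0).
Qed.

Lemma rel_zeror (A : opser) : lin_ser A -> Rel A (fun _ _ _ _ => 0).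
Proof.
move=> hA i j k l m n w.
by rewrite !(lin0 (@hA _ _ _)) /vif !if_same !(scaler0, subrr, addr0).
Qed.

(** * Stability of the common kernel of a matrix of series *)

Section KernelStable.
Variables (A B : opser) (w : V).
Hypotheses (pp' : p * p' = 1) (pnp' : p != p') (hAB : Rel A B).

Lemma p_neq0 : p != 0.
Proof.
by apply/eqP => e; move: pp'; rewrite e mul0r => /eqP; rewrite eq_sym oner_eq0.
Qed.
Lemma p'_neq0 : p' != 0.
Proof.
by apply/eqP => e; move: pp'; rewrite e mulr0 => /eqP; rewrite eq_sym oner_eq0.
Qed.

Lemma qq_neq0 i : qq i != 0.
Proof. by case: i; rewrite ?p_neq0 ?p'_neq0. Qed.
Lemma qv_neq0 i : qv i != 0.
Proof. by case: i; rewrite ?p_neq0 ?p'_neq0. Qed.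

(** On a vector killed by A, only the products A_ij(u) B_kl(v) and A_kj(u) B_il(v) survive in the
    relation. For i = k this is one equation, solved by [two_sided]; for i and k distinct it is the
    pair of equations of [cross_eq0]. *)
Lemma ker_stable_right : lin_ser B ->
  (exists N, forall k l w, B k l N w = 0 /\ B k l (N + 1) w = 0) -> lin_ser A ->
  (forall i j m, A i j m w = 0) -> forall i j m k l n, A i j m (B k l n w) = 0.
Proof.
move=> hB [N hN] hA w0 i j m k l n.
have os i' k' : one_sided (fun m n => A i' j m (B k' l n w)).
  by left; exists N => m'; rewrite (hN k' l w).1 (hN k' l w).2 !(lin0 (@hA _ _ _)).
have rel i' k' m' n' :
    oif (i' == k') (qv i') *: A i' j m' (B k' l (n' - 1) w)
    - oif (i' == k') (qq i') *: A i' j (m' - 1) (B k' l n' w)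
    = (sg i' k' k' l * (qq k' - qv k')) *:
      (vif (~~ k' && i') (A k' j (m' - 1) (B i' l n' w))
        + vif (~~ i' && k') (A k' j m' (B i' l (n' - 1) w))).
  have := hAB i' j k' l m' n' w; rewrite !w0 !(lin0 (@hB _ _ _)) /vif !if_same.
  by rewrite !(scaler0, subrr, addr0, subr0).
have dg i' m' n' : A i' j m' (B i' l n' w) = 0.
  move: m' n'; apply: (@two_sided _ _ _ _ (qv i') (qq i') (subsp0 V)); rewrite ?qq_neq0 ?qv_neq0 //.
    by move=> m' n'; have := rel i' i' m' n'; rewrite /oif eqxx andNb addr0 scaler0.
  by case: (os i' i') => [[M h]|[M h]]; [left|right]; exists M => x; rewrite (h x).1.
have [e1 e2] : A false j m (B true l n w) = 0 /\ A true j m (B false l n w) = 0.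
  move: m n; apply: (@cross_eq0 _ _ p p' (sg false true true l * (p' - p))
     (sg true false false l * (p - p')) (fun m n => A false j m (B true l n w))) => //.
  (* The two signs are opposite for either value of [l], so that the product of the constants is (p
     - p')^2. *)
  - by rewrite /sg; case: (l); rewrite /=; ring.
  - by move=> m' n'; have := rel false true m' n'; rewrite /oif /vif /= !scale1r add0r.
  - by move=> m' n'; have := rel true false m' n'; rewrite /oif /vif /= !scale1r addr0.
by case: i; case: k.
Qed.

(** The mirror image of [ker_stable_right]: the column indices j and l are now the ones exchanged,
    and the sign [sg i j k l] moves to the other side, being its own inverse. *)
Lemma ker_stable_left : lin_ser A ->
  (exists N, forall k l w, A k l N w = 0 /\ A k l (N + 1) w = 0) -> lin_ser B ->
  (forall k l n, B k l n w = 0) -> forall i j m k l n, B k l n (A i j m w) = 0.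
Proof.
move=> hA [N hN] hB w0 i j m k l n.
have os j' l' : one_sided (fun m n => B k l' n (A i j' m w)).
  by right; exists N => m'; rewrite (hN i j' w).1 (hN i j' w).2 !(lin0 (@hB _ _ _)).
pose c j' l' := sg i j' k l' * (sg i k k l' * (qq k - qv k)).
have sgK i1 i2 i3 i4 (x : V) : sg i1 i2 i3 i4 *: (sg i1 i2 i3 i4 *: x) = x.
  by rewrite scalerA /sg; case: ifP; rewrite ?mulrNN mulr1 scale1r.
have rel j' l' m' n' :
    oif (j' == l') (qv j') *: B k l' (n' - 1) (A i j' m' w)
    - oif (j' == l') (qq j') *: B k l' n' (A i j' (m' - 1) w)
    = c j' l' *:
      (vif (~~ j' && l') (B k j' n' (A i l' (m' - 1) w))
        + vif (~~ l' && j') (B k j' (n' - 1) (A i l' m' w))).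
  have := hAB i j' k l' m' n' w; rewrite !w0 !(lin0 (@hA _ _ _)) /vif !if_same.
  rewrite !(scaler0, oppr0, subrr, addr0, sub0r) scalerN => /oppr_inj e.
  by rewrite /c -[in RHS]scalerA -e sgK.
have dg j' m' n' : B k j' n' (A i j' m' w) = 0.
  move: m' n'; apply: (@two_sided _ _ _ _ (qv j') (qq j') (subsp0 V)); rewrite ?qq_neq0 ?qv_neq0 //.
    by move=> m' n'; have := rel j' j' m' n'; rewrite /oif eqxx andNb addr0 scaler0.
  by case: (os j' j') => [[M h]|[M h]]; [left|right]; exists M => x; rewrite (h x).1.
have [e1 e2] : B k false n (A i true m w) = 0 /\ B k true n (A i false m w) = 0.
  move: m n; apply: (@cross_eq0 _ _ p p' (c true false)
     (c false true) (fun m n => B k false n (A i true m w))) => //.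
  - by rewrite /c /sg; case: (i); case: (k); rewrite /=; ring.
  - by move=> m' n'; have := rel true false m' n'; rewrite /oif /vif /= !scale1r add0r.
  - by move=> m' n'; have := rel false true m' n'; rewrite /oif /vif /= !scale1r addr0.
by case: j; case: l.
Qed.

End KernelStable.

End RTT.

(** * Triangular decomposition and singular vectors *)

Section System.
Variables (K : fieldType) (V : lmodType K) (p p' : K).
Hypothesis pp' : p * p' = 1.

Notation opser := (opser V).
Notation Rel := (@Rel K V p p').

Let p0 := p_neq0 pp'.
Let p'0 := p'_neq0 pp'.

(* [inr b m]: the exponent [m] occurs in [t(u)] ([b = false]), resp. in
   [\bar t(u)] ([b = true]). *)
Definition inr (b : bool) (m : int) := if b then 0 <= m else m <= 0.

(** The condition [b ==> b'] selects the three pairs (t, t), (\bar t, \bar t), (t, \bar t) of the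
    presentation. *)
Record rtt_sys (T : bool -> opser) : Prop := RttSys {
  sys_lin : forall b, lin_ser (T b);
  sys_supp : forall b i j m w, ~~ inr b m -> T b i j m w = 0;
  sys_rel : forall b b', b ==> b' -> Rel (T b) (T b')
}.

Definition stable (T : bool -> opser) (S : V -> Prop) :=
  forall b i j m w, S w -> S (T b i j m w).

Section PBW.
Variables (T : bool -> opser) (hT : rtt_sys T).

Let lin b i j m : linear (T b i j m) := @sys_lin _ hT b i j m.

(** An exponent absent from the series; it provides the vanishing row or column that [two_sided]
    requires. *)
Definition oob (b : bool) : int := if b then -1 else 1.
Lemma oob0 b i j w : T b i j (oob b) w = 0.
Proof. by apply: (sys_supp hT); case: b. Qed.

Lemma oob2 b : exists N, forall k l w, T b k l N w = 0 /\ T b k l (N + 1) w = 0.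
Proof.
by exists (if b then -2 else 1) => k l w; split; apply: (sys_supp hT); case: b.
Qed.

Fixpoint lev (W : V -> Prop) n : V -> Prop :=
  if n is n'.+1 then
    span (fun v => exists b m w, lev W n' w /\ v = T b true false m w)
  else W.

Variables (W : V -> Prop) (hW : subsp W).

Lemma subsp_lev n : subsp (lev W n).
Proof. by case: n => [|n] //=; exact: subsp_span. Qed.

Lemma levS n b m w : lev W n w -> lev W n.+1 (T b true false m w).
Proof. by move=> h; apply: span_mem; exists b, m, w. Qed.

Hypothesis W_diag : forall b i m w, W w -> W (T b i i m w).
Hypothesis W_12 : forall b m w, W w -> T b false true m w = 0.

Ltac sub hS := repeat first
  [ apply: (subspD hS) | apply: (subspN hS) | apply: (subspZ hS) ].

(** By induction on the number of lowering operators: a diagonal or raising operator is moved past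
    the outermost T_21. The relation controls the product only up to a factor a v - b u, which
    [two_sided] removes. At n = 0 the truncated [n.-1] is harmless, because T_12 kills [W]. *)
Lemma lev_stable n :
  (forall b i m w, lev W n w -> lev W n (T b i i m w)) /\
  (forall b m w, lev W n w -> lev W n.-1 (T b false true m w)).
Proof.
elim: n => [|n [IHd IH12]].
  by split=> [|b m w /W_12 ->]; [exact: W_diag | exact: hW.1].
have hS := subsp_lev n.+1.
have L b m w : lev W n w -> lev W n.+1 (T b true false m w) by exact: levS.
have sv b (X : int -> int -> V) S : subsp S -> (forall m, X m (oob b) = 0) ->
    (exists N, forall m, S (X m N)) \/ (exists M, forall n, S (X M n)).
  by move=> h hX; left; exists (oob b) => m; rewrite hX; exact: h.1.
have su b (X : int -> int -> V) S : subsp S -> (forall n, X (oob b) n = 0) ->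
    (exists N, forall m, S (X m N)) \/ (exists M, forall n, S (X M n)).
  by move=> h hX; right; exists (oob b) => m; rewrite hX; exact: h.1.
have d1 b b' m n' w : b ==> b' -> lev W n w ->
    lev W n.+1 (T b false false m (T b' true false n' w)).
  move=> bb hw; move: m n'.
  apply: (@two_sided _ _ _ _ 1 1 hS); rewrite ?oner_eq0 //.
    move=> m n'; rewrite (rel1121 (sys_rel hT bb)).
    by sub hS; apply: L => //; exact: IHd.
  by apply: (@su b) => // n'; rewrite oob0.
(* For \bar t applied after t, the relation with the indices in the other order is used; its extra
   term is covered by [d1]. The same device gives [d2'] from [d2]. *)
have d1' m n' w : lev W n w ->
    lev W n.+1 (T true false false n' (T false true false m w)).
  move=> hw; move: m n'.
  apply: (@two_sided _ _ _ _ p' p hS) => //.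
    move=> m n'; rewrite (rel2111 (sys_rel hT (b := false) (b' := true) isT)).
    by sub hS; first [by apply: d1 | by apply: L => //; exact: IHd].
  by apply: (@sv true) => // m; rewrite oob0.
have d2 b b' m n' w : b ==> b' -> lev W n w ->
    lev W n.+1 (T b' true true n' (T b true false m w)).
  move=> bb hw; move: m n'.
  apply: (@two_sided _ _ _ _ 1 1 hS); rewrite ?oner_eq0 //.
    move=> m n'; rewrite (rel2122 (sys_rel hT bb)).
    by sub hS; apply: L => //; exact: IHd.
  by apply: (@sv b') => // m; rewrite oob0.
have d2' m n' w : lev W n w ->
    lev W n.+1 (T false true true m (T true true false n' w)).
  move=> hw; move: m n'.
  apply: (@two_sided _ _ _ _ p p' hS) => //.
    move=> m n'; rewrite (rel2221 (sys_rel hT (b := false) (b' := true) isT)).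
    by sub hS; first [by apply: d2 | by apply: L => //; exact: IHd].
  by apply: (@su false) => // m; rewrite oob0.
have hS' := subsp_lev n.
(* T_12 lowers the level by one and T_21 restores it; at level 0 the inner vector is zero. *)
have L' b m b' m' w : lev W n w ->
    lev W n (T b true false m (T b' false true m' w)).
  case: n {L d1 d1' d2 d2' hS} IH12 hS' IHd => [|k] IH12 hS' IHd hw.
    by rewrite W_12 // (lin0 (@lin _ _ _ _)); exact: hW.1.
  by apply: levS; exact: IH12.
have D b i m b' i' m' w : lev W n w -> lev W n (T b i i m (T b' i' i' m' w)).
  by move=> hw; do 2 apply: (IHd).
have c1 b b' m n' w : b ==> b' -> lev W n w ->
    lev W n (T b false true m (T b' true false n' w)).
  move=> bb hw; move: m n'.
  apply: (@two_sided _ _ _ _ 1 1 hS'); rewrite ?oner_eq0 //.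
    move=> m n'; rewrite (rel1221 (sys_rel hT bb)).
    by sub hS'; first [exact: L' | exact: D].
  by apply: (@su b) => // m; rewrite oob0.
have c2 m n' w : lev W n w ->
    lev W n (T true false true n' (T false true false m w)).
  move=> hw; move: m n'.
  apply: (@two_sided _ _ _ _ 1 1 hS'); rewrite ?oner_eq0 //.
    move=> m n'; rewrite (rel2112 (sys_rel hT (b := false) (b' := true) isT)).
    by sub hS'; first [exact: L' | exact: D].
  by apply: (@sv true) => // m; rewrite oob0.
split=> [b i m w|b m w].
  apply: (span_sub (S := fun v => lev W n.+1 (T b i i m v))).
    exact: subsp_preim.
  by move=> _ [b' [m' [v [hv ->]]]]; case: i; case: b; case: b'; auto.
apply: (span_sub (S := fun v => lev W n (T b false true m v))).
  exact: subsp_preim.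
by move=> _ [b' [m' [v [hv ->]]]]; case: b; case: b'; auto.
Qed.

Definition total := span (fun v => exists n, lev W n v).

Lemma total_stable : stable T total.
Proof.
move=> b i j m; apply: (span_sub (S := fun v => total (T b i j m v))).
  by apply: subsp_preim => //; exact: subsp_span.
move=> w [n hw]; apply: span_mem; case: (lev_stable n) => h1 h2.
case: i; case: j.
- by exists n; apply: h1.
- by exists n.+1; apply: levS.
- by exists n.-1; apply: h2.
- by exists n; apply: h1.
Qed.

End PBW.

(** Applying f - mu_N removes the last summand and multiplies the others by non-zero scalars. *)
Lemma eigen_indep (f : V -> V) (mu : nat -> K) N (e : nat -> V) : linear f ->
  injective mu -> (forall i, f (e i) = mu i *: e i) ->
  \sum_(i < N) e i = 0 -> forall i, (i < N)%N -> e i = 0.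
Proof.
move=> hf mu_inj; elim: N e => // N IH e he hs.
have e0 : forall i, (i < N)%N -> e i = 0.
  move=> i hi; suff: (mu i - mu N) *: e i = 0.
    move/eqP; rewrite scaler_eq0 subr_eq0 => /orP[/eqP/mu_inj E|/eqP //].
    by rewrite E ltnn in hi.
  move: i hi; apply: (IH (fun i => (mu i - mu N) *: e i)) => [i|].
    by rewrite (linZ hf) he !scalerA mulrC.
  have := congr1 f hs; rewrite (lin0 hf) (lin_sum hf) => h1.
  have := congr1 (fun x => mu N *: x) hs; rewrite scaler0 => h2.
  have := congr2 (fun x y => x - y) h1 h2; rewrite subrr scaler_sumr -sumrB.
  rewrite big_ord_recr /= he subrr addr0 => h3; rewrite -[RHS]h3.
  by apply: eq_bigr => i _; rewrite he scalerBl.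
move=> i; rewrite ltnS leq_eqVlt => /orP[/eqP ->|]; last exact: e0.
by move: hs; rewrite big_ord_recr /= big1 ?add0r // => j _; exact: e0.
Qed.

(** * Absence of singular vectors below the highest weight vector *)

Section Singular.
Variables (T : bool -> opser) (hT : rtt_sys T).
Hypothesis p_inj : injective (fun n => p ^+ n).
Variables (par : V -> V) (hpar : linear par) (eps : bool -> K).
Hypothesis par_T : forall b i j m w,
  par (T b i j m w) = eps (i (+) j) *: T b i j m (par w).
Hypotheses (eps0 : eps false = 1) (eps_neq0 : forall b, eps b != 0).
Hypothesis irr : forall S, subsp S -> stable T S -> (forall v, S v -> S (par v)) ->
  (forall v, S v -> v = 0) \/ (forall v, S v).
Variables (z : V) (la : K).
Hypotheses (z0 : z != 0) (la0 : la != 0) (hz : T false false false 0 z = la *: z).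

Let lin b i j m : linear (T b i j m) := @sys_lin _ hT b i j m.

(** This is the relation at u^1, where only the constant coefficient of t_11(u) survives, since t(u)
    has no positive exponents. *)
Lemma t11_t21 b m w : T false false false 0 (T b true false m w) =
  p *: T b true false m (T false false false 0 w).
Proof.
have r : false ==> b by [].
have h := @rel1121 _ _ _ _ _ _ (sys_rel hT r) 1 m w.
have s1 x i j : T false i j 1 x = 0 by apply: (sys_supp hT).
rewrite subrr !s1 (lin0 (@lin _ _ _ _)) !(scaler0, sub0r, addr0, scale1r) in h.
by move/oppr_inj: h.
Qed.

Lemma t11_t22 b m w : T false false true 0 w = 0 ->
  T false false false 0 (T b true true m w) =
  T b true true m (T false false false 0 w).
Proof.
move=> h12; have r : false ==> b by [].
have h := @rel1122 _ _ _ _ _ _ (sys_rel hT r) 1 m w.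
have s1 x i j : T false i j 1 x = 0 by apply: (sys_supp hT).
rewrite subrr !s1 h12 !(lin0 (@lin _ _ _ _)) !(subrr, scaler0, sub0r, subr0, scale1r) in h.
by move/oppr_inj: h.
Qed.

Lemma t11_t11 b m w : T false false false 0 (T b false false m w) =
  T b false false m (T false false false 0 w).
Proof.
have r : false ==> b by [].
have h := @rel1111 _ _ _ _ _ _ (sys_rel hT r) 1 m w.
have s1 x i j : T false i j 1 x = 0 by apply: (sys_supp hT).
rewrite subrr !s1 !(lin0 (@lin _ _ _ _)) !(scaler0, sub0r) in h.
by move/oppr_inj/(scalerI p0): h.
Qed.

(** Singular vectors one step below [z]: by [t11_t21] the factor [p] is what one application of T_21
    contributes to the eigenvalue. *)
Definition sing (w : V) :=
  T false false false 0 w = (p * la) *: w /\ forall b m, T b false true m w = 0.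

Lemma subsp_sing : subsp sing.
Proof.
split=> [|a v w [h1 h2] [h3 h4]].
  by split=> [|b m]; rewrite (lin0 (@lin _ _ _ _)) ?scaler0.
split=> [|b m]; rewrite lin ?h1 ?h3 ?h2 ?h4 ?scaler0 ?addr0 //.
by rewrite scalerDr !scalerA mulrC.
Qed.

(** Since T_12 kills [w], t_11^(0) commutes with T_ii on [w], and the relations leave only a linear
    factor in u and v times T_12 T_ii w, which [two_sided] cancels. *)
Lemma sing_diag b i m w : sing w -> sing (T b i i m w).
Proof.
move=> [h1 h2]; split.
  by case: i; rewrite ?t11_t11 ?t11_t22 ?h1 ?h2 ?(linZ (@lin _ _ _ _)).
have sv b2 (X : int -> int -> V) : (forall m, X m (oob b2) = 0) ->
    (exists N, forall m, X m N = 0) \/ (exists M, forall n, X M n = 0).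
  by move=> hX; left; exists (oob b2).
have su b2 (X : int -> int -> V) : (forall n, X (oob b2) n = 0) ->
    (exists N, forall m, X m N = 0) \/ (exists M, forall n, X M n = 0).
  by move=> hX; right; exists (oob b2).
have z12 b1 m1 b2 i2 j2 m2 : T b2 i2 j2 m2 (T b1 false true m1 w) = 0.
  by rewrite h2 (lin0 (@lin _ _ _ _)).
have d1 b1 b2 m1 m2 : b1 ==> b2 -> T b2 false true m2 (T b1 false false m1 w) = 0.
  move=> r; move: m1 m2; apply: (@two_sided _ _ _ _ 1 1 (subsp0 V)); rewrite ?oner_eq0 //.
    by move=> m1 m2; rewrite (rel1112 (sys_rel hT r)) !z12 !(scaler0, subr0, addr0).
  by apply: (@sv b2) => m'; rewrite (oob0 hT).
have d2 b1 b2 m1 m2 : b1 ==> b2 -> T b1 false true m1 (T b2 true true m2 w) = 0.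
  move=> r; move: m1 m2; apply: (@two_sided _ _ _ _ 1 1 (subsp0 V)); rewrite ?oner_eq0 //.
    by move=> m1 m2; rewrite (rel1222 (sys_rel hT r)) !z12 !(scaler0, subr0).
  by apply: (@su b1) => m'; rewrite (oob0 hT).
have d1' m1 m2 : T false false true m1 (T true false false m2 w) = 0.
  move: m1 m2; apply: (@two_sided _ _ _ _ p' p (subsp0 V)) => //.
    move=> m1 m2; rewrite (rel1211 (sys_rel hT (b := false) (b' := true) isT)).
    by rewrite !z12 d1 // !(scaler0, subr0).
  by apply: (@su false) => m'; rewrite (oob0 hT).
have d2' m1 m2 : T true false true m2 (T false true true m1 w) = 0.
  move: m1 m2; apply: (@two_sided _ _ _ _ p p' (subsp0 V)) => //.
    move=> m1 m2; rewrite (rel2212 (sys_rel hT (b := false) (b' := true) isT)).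
    by rewrite !z12 d2 // !(scaler0, subr0, addr0).
  by apply: (@sv true) => m'; rewrite (oob0 hT).
by move=> b2 m2; case: i; case: b; case: b2; auto.
Qed.

Lemma sing_par w : sing w -> sing (par w).
Proof.
move=> [h1 h2]; split=> [|b m].
  by have := par_T false false false 0 w; rewrite eps0 scale1r => <-; rewrite h1 (linZ hpar).
apply/eqP; have := par_T b false true m w; rewrite h2 (lin0 hpar) => /esym/eqP.
by rewrite scaler_eq0 (negbTE (eps_neq0 _)).
Qed.

Lemma lev_par W n w : (forall v, W v -> W (par v)) -> subsp W ->
  lev T W n w -> lev T W n (par w).
Proof.
move=> hW sW; elim: n w => [|n IH] w; first exact: hW.
have sS := subsp_lev T sW n.+1.
move: w; apply: (span_sub (S := fun v => lev T W n.+1 (par v))).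
  exact: subsp_preim.
move=> _ [b [m [v [hv ->]]]]; rewrite par_T; apply: (subspZ sS).
by apply: levS; exact: IH.
Qed.

Lemma lev_eigen n w : lev T sing n w ->
  T false false false 0 w = (p ^+ n.+1 * la) *: w.
Proof.
elim: n w => [|n IH] w; first by case.
move: w; apply: (span_sub (S := fun w => T false false false 0 w = (p ^+ n.+2 * la) *: w)).
  split=> [|a v w hv hw]; first by rewrite (lin0 (@lin _ _ _ _)) scaler0.
  by rewrite lin hv hw scalerDr !scalerA mulrC.
move=> _ [b [m [v [hv ->]]]].
by rewrite t11_t21 IH // (linZ (@lin _ _ _ _)) scalerA mulrA -exprS.
Qed.

(** The singular vectors generate a stable graded subspace on which t_11^(0) has eigenvalues p^(n+1)
    la with n >= 0. None of them is [la], so [z] lies outside, and irreducibility makes the subspace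
    zero. *)
Lemma sing_eq0 w : sing w -> w = 0.
Proof.
move=> hw; have hs := subsp_sing.
case: (irr (subsp_span _) (total_stable hT hs sing_diag (fun b m w h => h.2 b m))).
- apply: (span_sub (S := fun v => total T sing (par v))).
    by apply: subsp_preim => //; exact: subsp_span.
  move=> v [n hv]; apply: span_mem; exists n.
  by apply: lev_par => //; exact: sing_par.
- by apply; apply: span_mem; exists 0%N.
move=> hall; have {hall} := hall z.
(* [S] consists of the finite sums of such eigenvectors, indexed by the exponent of p. Sums of
   different lengths are padded with zeros to be added. *)
pose S v := exists N (e : nat -> V),
  (forall i, T false false false 0 (e i) = (p ^+ i.+1 * la) *: e i) /\
  v = \sum_(i < N) e i.
have hS : subsp S.
  split; first by exists 0%N, (fun _ => 0); split=> [i|];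
    rewrite ?big_ord0 // (lin0 (@lin _ _ _ _)) scaler0.
  move=> a v1 v2 [N1 [e1 [h1 ->]]] [N2 [e2 [h2 ->]]].
  have ext N M (e : nat -> V) : \sum_(i < N) e i =
      \sum_(i < N + M) (if (i < N)%N then e i else 0).
    rewrite big_split_ord /= [X in _ + X]big1 ?addr0 => [|i _].
      by apply: eq_bigr => i _; rewrite ltn_ord.
    by rewrite ltnNge leq_addr.
  exists (N1 + N2)%N, (fun i => a *: (if (i < N1)%N then e1 i else 0)
                          + (if (i < N2)%N then e2 i else 0)); split.
    have eigP N (e : nat -> V) i : T false false false 0 (e i) = (p ^+ i.+1 * la) *: e i ->
        T false false false 0 (if (i < N)%N then e i else 0)
        = (p ^+ i.+1 * la) *: (if (i < N)%N then e i else 0).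
      by case: ifP; rewrite // (lin0 (@lin _ _ _ _)) scaler0.
    by move=> i; rewrite lin !eigP // scalerDr !scalerA [_ * a]mulrC.
  rewrite big_split /= -scaler_sumr (ext N1 N2) (ext N2 N1).
  by rewrite (addnC N2 N1).
move/(_ S hS) => h; have {h} : S z.
  apply: h => v [n hv]; exists n.+1, (fun i => if i == n then v else 0); split=> [i|].
    by case: eqP => [->|_]; rewrite ?(lin0 (@lin _ _ _ _)) ?scaler0 ?(lev_eigen hv).
  rewrite big_ord_recr /= eqxx big1 ?add0r // => i _.
  by rewrite (ltn_eqF (ltn_ord i)).
move=> [N [e [he ez]]].
have mu_inj : injective (fun n => p ^+ n * la) by move=> i j /(mulIf la0)/p_inj.
(* Placing -z at exponent 0 in front of the decomposition of [z] gives eigenvectors with distinct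
   eigenvalues and sum zero. *)
have := eigen_indep (N := N.+1) (e := fun i => if i is i'.+1 then e i' else - z)
  (@lin false false false 0) mu_inj.
move=> h; suff : - z = 0 by move/eqP; rewrite oppr_eq0 (negbTE z0).
apply: (h _ _ 0%N isT) => [[|i]|]; rewrite ?he //.
  by rewrite (linN (@lin _ _ _ _)) hz expr0 mul1r scalerN.
by rewrite big_ord_recl /= -ez addNr.
Qed.

End Singular.
End System.

(** * Rational weights give finite dimension *)

Section Sufficiency.
Variables (K : fieldType) (V : lmodType K) (p p' : K).
Hypotheses (pp' : p * p' = 1) (pnp' : p != p') (ppp' : p + p' != 0).
Hypothesis p_inj : injective (fun n => p ^+ n).
Variables (T : bool -> opser V) (hT : rtt_sys p p' T).
Variables (par : V -> V) (hpar : linear par) (eps : bool -> K).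
Hypothesis par_T : forall b i j m w,
  par (T b i j m w) = eps (i (+) j) *: T b i j m (par w).
Hypotheses (eps0 : eps false = 1) (eps_neq0 : forall b, eps b != 0).
Hypothesis irr : forall S, subsp S -> stable T S -> (forall v, S v -> S (par v)) ->
  (forall v, S v -> v = 0) \/ (forall v, S v).
Variables (z : V) (wt : bool -> bool -> int -> K).
Hypotheses (z0 : z != 0) (hz12 : forall b m, T b false true m z = 0).
Hypothesis hzd : forall b i m, T b i i m z = wt b i m *: z.
Hypothesis wt0 : wt false false 0 != 0.
Hypothesis gen : forall S, subsp S -> stable T S -> S z -> forall v, S v.
Variable N : nat.
Hypothesis hwt : forall i m, wt true i m = wt false i (m - Posz N).

Let lin b i j m : linear (T b i j m) := @sys_lin _ _ _ _ _ hT b i j m.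
Let p0 := p_neq0 pp'.

(** This is \bar t_ij(u) - u^N t_ij(u), with the scalar -1 written out to match [rel_linl] and
    [rel_linr]. *)
Definition defect : opser V := fun i j m w =>
  -1 *: T false i j (m + - Posz N) w + T true i j m w.

Lemma defect_lin : lin_ser defect.
Proof.
move=> i j m a v w; rewrite /defect !lin; module_simpl; ring.
Qed.

Lemma rel_T_defect : Rel p p' (T false) defect.
Proof.
apply: rel_linr; [exact: (sys_lin hT)|exact: (sys_rel hT)|exact: (sys_rel hT)].
Qed.

Lemma rel_defect_T : Rel p p' defect (T true).
Proof.
apply: rel_linl; [exact: (sys_lin hT)|exact: (sys_rel hT)|exact: (sys_rel hT)].
Qed.

Lemma defect_diag i m : defect i i m z = 0.
Proof. by rewrite /defect !hzd hwt scaleN1r addNr. Qed.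

(** The vector is singular: [t11_t21] gives its eigenvalue, and as the diagonal defects and T_12
    kill [z], the relations reduce to (v - u) T_12 D_21 z = 0 for t_12 and for \bar t_12. *)
Lemma defect_21 m : defect true false m z = 0.
Proof.
apply: (sing_eq0 pp' hT p_inj hpar par_T eps0 eps_neq0 irr z0 wt0 (hzd _ _ _)).
have Dd i m1 b i' m2 : defect i i m1 (T b i' i' m2 z) = 0.
  by rewrite hzd (linZ (@defect_lin _ _ _)) defect_diag scaler0.
have Td i m1 b i' m2 : T b i' i' m2 (defect i i m1 z) = 0.
  by rewrite defect_diag (lin0 (@lin _ _ _ _)).
have D12 m1 b m2 : defect true false m1 (T b false true m2 z) = 0.
  by rewrite hz12 (lin0 (@defect_lin _ _ _)).
split.
  rewrite {1}/defect lin !(t11_t21 hT) hzd.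
  rewrite !(linZ (@lin _ _ _ _)) /defect; module_simpl; ring.
case=> n.
  move: m n; apply: (@two_sided _ _ _ _ 1 1 (subsp0 V)); rewrite ?oner_eq0 //.
    by move=> m n; rewrite (rel2112 rel_defect_T) !D12 Dd Td !(scaler0, subrr, oppr0).
  by left; exists (-1) => m; apply: (oob0 hT true).
move: n m; apply: (@two_sided _ _ _ _ 1 1 (subsp0 V)); rewrite ?oner_eq0 //.
  by move=> m n; rewrite (rel1221 rel_T_defect) !D12 Dd Td !(scaler0, subrr, oppr0, addr0).
by right; exists 1 => m; apply: (oob0 hT false).
Qed.

(** The common kernel of the defects contains [z]; it is stable under \bar t by [ker_stable_right]
    and under t by [ker_stable_left]. *)
Lemma defect0 i j m w : defect i j m w = 0.
Proof.
move: w i j m; apply: (@gen (fun w => forall i j m, defect i j m w = 0)).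
- split=> [i j m|a v w hv hw i j m]; first by rewrite (lin0 (@defect_lin _ _ _)).
  by rewrite defect_lin hv hw scaler0 addr0.
- move=> [] i j m w hw i' j' m'.
    apply: (ker_stable_right pp' pnp' rel_defect_T) => //;
      [exact: (oob2 hT)|exact: defect_lin].
  apply: (ker_stable_left pp' pnp' rel_T_defect) => //;
    [exact: (oob2 hT)|exact: defect_lin].
case=> [] [] m; rewrite ?defect_diag ?defect_21 //.
by rewrite /defect !hz12 scaler0 addr0.
Qed.

Lemma T_true i j m w : T true i j m w = T false i j (m - Posz N) w.
Proof.
have /eqP := defect0 i j m w.
by rewrite /defect scaleN1r addrC subr_eq0 => /eqP.
Qed.

Definition low (r : nat) := T false true false (- Posz r).

Lemma low_lin r : linear (low r). Proof. exact: lin. Qed.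

(** By [T_true] this is the coefficient of u^(N - r) in \bar t_21(u), which has no negative
    exponents. *)
Lemma low0 r w : (N < r)%N -> low r w = 0.
Proof.
move=> hr; have := T_true true false (Posz N - Posz r) w.
rewrite (_ : Posz N - Posz r - Posz N = - Posz r); last by lia.
by rewrite /low => <-; apply: (sys_supp hT) => /=; lia.
Qed.

(** The exponent [1 - Posz s] stands for the index s - 1; at s = 0 it is out of range and the term
    vanishes. *)
Lemma low_rel r s w : p *: low r (low s w) =
  p *: T false true false (1 - Posz s) (low r.+1 w) - p' *: low s (low r w)
  + p' *: low r.+1 (T false true false (1 - Posz s) w).
Proof.
have h := @rel2121 _ _ _ _ _ _ (sys_rel hT (b := false) (b' := false) isT)
  (1 - Posz s) (- Posz r) w.
rewrite (_ : 1 - Posz s - 1 = - Posz s) in h; last by lia.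
rewrite (_ : - Posz r - 1 = - Posz r.+1) in h; last by lia.
by apply: (lin_from (c := -1) h); rewrite /low; module_simpl; ring.
Qed.

(* Moving the pair [(r, s)] outwards while [s] decreases terminates because
   [low] has no term of index [-1]. *)
Lemma low_swap s r w : (s <= r)%N ->
  span (fun v => exists a b, [/\ (a <= s)%N, (a < r)%N & v = low a (low b w)])
    (low r (low s w)).
Proof.
elim: s r => [|s IH] r sr.
  have h := low_rel r 0 w.
  rewrite subr0 !(oob0 hT false) (lin0 (@low_lin _)) !scaler0 addr0 sub0r in h.
  have hS := subsp_span (fun v => exists a b, [/\ (a <= 0)%N, (a < r)%N & v = low a (low b w)]).
  apply: (subspZE hS p0); rewrite h; apply: (subspN hS); apply: (subspZ hS).
  (* At r = 0 the relation reads (p + p') x_0 x_0 = 0. *)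
  case: r sr h hS => [|r] _ h hS; last by apply: span_mem; exists 0%N, r.+1.
  have {}h : (p + p') *: low 0 (low 0 w) = 0 by rewrite scalerDl h addNr.
  by move/eqP: h; rewrite scaler_eq0 (negbTE ppp') => /eqP ->; exact: hS.1.
have h := low_rel r s.+1 w.
rewrite (_ : 1 - Posz s.+1 = - Posz s) in h; last by lia.
have hS := subsp_span (fun v => exists a b, [/\ (a <= s.+1)%N, (a < r)%N & v = low a (low b w)]).
have h1 : span (fun v => exists a b, [/\ (a <= s.+1)%N, (a < r)%N & v = low a (low b w)])
    (low r.+1 (low s w)).
  apply: (span_sub hS) (IH r.+1 _); last by lia.
  by move=> _ [a [b [h1 h2 ->]]]; apply: span_mem; exists a, b; split=> //; lia.
have h2 : span (fun v => exists a b, [/\ (a <= s.+1)%N, (a < r)%N & v = low a (low b w)])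
    (low s (low r.+1 w)).
  by apply: span_mem; exists s, r.+1; split=> //; lia.
(* When both indices agree, the middle term of [h] repeats the left side; collecting them gives the
   invertible factor p + p'. *)
move: sr; rewrite leq_eqVlt => /orP[/eqP e|sr].
  rewrite -e in h h1 h2 hS *; apply: (subspZE hS ppp').
  have -> : (p + p') *: low s.+1 (low s.+1 w) =
      p *: low s (low s.+2 w) + p' *: low s.+2 (low s w).
    by rewrite scalerDl h; rewrite /low; module_simpl; ring.
  by apply: (subspD hS); apply: (subspZ hS).
apply: (subspZE hS p0); rewrite h.
apply: (subspD hS); last exact: (subspZ hS).
apply: (subspB hS); apply: (subspZ hS) => //.
by apply: span_mem; exists s.+1, r; split=> //; lia.
Qed.

(** Strictly increasing words of length [n]; the lower bound [j] on the indices allows them to be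
    built from the outside. *)
Fixpoint asc n j : V -> Prop :=
  if n is n'.+1 then
    span (fun v => exists r w, [/\ (j <= r)%N, asc n' r.+1 w & v = low r w])
  else fun v => exists c, v = c *: z.

Lemma subsp_asc n j : subsp (asc n j).
Proof.
case: n => [|n] /=; last exact: subsp_span.
split=> [|a v w [c ->] [d ->]]; first by exists 0; rewrite scale0r.
by exists (a * c + d); rewrite scalerDl scalerA.
Qed.

Lemma asc_mono n i j v : (i <= j)%N -> asc n j v -> asc n i v.
Proof.
case: n => [|n] //= ij; apply: span_sub; first exact: subsp_span.
move=> _ [r [w [jr hw ->]]]; apply: span_mem; exists r, w; split=> //.
exact: leq_trans jr.
Qed.

(** Induction on the length, then on [r]. If [r] is below the first index, the word is already
    increasing; otherwise [low_swap] replaces [r] by smaller outer indices. *)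
Lemma asc_low n r v : asc n 0 v -> asc n.+1 0 (low r v).
Proof.
elim: n r v => [|n IHn] r v hv; first by apply: span_mem; exists r, v.
elim/ltn_ind: r v hv => r IHr.
apply: (span_sub (S := fun v => asc n.+2 0 (low r v))).
  by apply: subsp_preim; [exact: low_lin | exact: subsp_asc].
move=> _ [s [w [_ hw ->]]].
have [rs|sr] := ltnP r s.
  apply: span_mem; exists r, (low s w); split=> //.
  by apply: span_mem; exists s, w.
apply: (span_sub (subsp_asc n.+2 0) _ (low_swap (w := w) sr)) => _ [a [b [_ ar ->]]].
by apply: IHr => //; apply: IHn; exact: asc_mono hw.
Qed.

(** The innermost of n + 1 increasing indices starting from j is at least j + n > N, so [low0]
    applies to it. *)
Lemma asc_eq0 n j v : (N < n + j)%N -> asc n.+1 j v -> v = 0.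
Proof.
elim: n j v => [|n IH] j v hn; apply: (span_sub (S := fun v => v = 0) (subsp0 V)).
  move=> _ [r [w [jr _ ->]]]; apply: low0; exact: leq_trans jr.
move=> _ [r [w [jr hw ->]]]; rewrite (IH r.+1 w _ hw) ?(lin0 (@low_lin _)) //.
by apply: leq_trans hn _; rewrite addSnnS leq_add2l ltnS.
Qed.

Fixpoint words n : seq V :=
  if n is n'.+1 then [seq low r w | r <- iota 0 N.+1, w <- words n'] else [:: z].

Lemma asc_words n j v : asc n j v -> span (fun w => w \in words n) v.
Proof.
elim: n j v => [|n IH] j v.
  case=> c ->; apply: (subspZ (subsp_span _)).
  by apply: span_mem; rewrite inE.
have hS := subsp_span (fun w => w \in words n.+1).
apply: (span_sub hS) => _ [r [w [_ /IH hw ->]]].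
have [rN|Nr] := leqP r N; last by rewrite low0 //; exact: hS.1.
move: w hw; apply: (span_sub (S := fun w => span (fun w => w \in words n.+1) (low r w))).
  by apply: subsp_preim => //; exact: low_lin.
move=> u hu; apply: span_mem; apply/allpairsP; exists (r, u); split=> //=.
by rewrite -[0%N :: _]/(iota 0 N.+1) mem_iota.
Qed.

Lemma span_seq : exists L : seq V, forall v, span (fun w => w \in L) v.
Proof.
(* The indices run from 0 to N, so increasing words have length at most N + 1. *)
pose L := flatten [seq words n | n <- iota 0 N.+2].
exists L => v.
have hZ : subsp (fun v => exists c : K, v = c *: z) := subsp_asc 0 0.
have levL n w : lev T (fun v => exists c : K, v = c *: z) n w -> asc n 0 w.
  elim: n w => [|n IH] w //; apply: (span_sub (subsp_asc n.+1 0)).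
  move=> _ [b [m [u [/IH hu ->]]]].
  have ascT m' : asc n.+1 0 (T false true false m' u).
    have [h|h] := leP m' 0; last first.
      rewrite (sys_supp hT) //=; first exact: (subsp_asc n.+1 0).1.
      by rewrite -ltNge.
    have -> : m' = - Posz `|m'|%N by lia.
    exact: asc_low.
  by case: b; rewrite ?T_true.
suff : total T (fun v => exists c : K, v = c *: z) v.
  apply: (span_sub (subsp_span _)) => w [n /levL]; have [nN|Nn] := leqP n N.+1.
    move=> /asc_words; apply: (span_sub (subsp_span _)) => u hu.
    apply: span_mem; apply/flatten_mapP; exists n => //.
    by rewrite mem_iota.
  case: n Nn => // n Nn /asc_eq0 ->; last by rewrite addn0.
  exact: (subsp_span _).1.
apply: gen; first exact: subsp_span.
- apply: (total_stable pp' hT) => //.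
    by move=> b i m _ [c ->]; exists (c * wt b i m); rewrite (linZ (@lin _ _ _ _)) hzd scalerA.
  by move=> b m _ [c ->]; rewrite (linZ (@lin _ _ _ _)) hz12 scaler0.
- by apply: span_mem; exists 0%N; exists 1; rewrite scale1r.
Qed.

End Sufficiency.

(** * Power series and rescaling *)

Section PowerSeriesTheory.
Variable K : fieldType.
Implicit Types (a b c d : nat -> K).

(** Truncation transfers the ring identities of polynomials to Cauchy products. *)
Lemma fps_mulE n a b m : (m < n)%N ->
  fps_mul a b m = ((\poly_(i < n) a i) * (\poly_(i < n) b i))`_m.
Proof.
move=> mn; rewrite coefM; apply: eq_bigr => -[i /= im] _.
by rewrite !coef_poly (leq_trans im mn) (leq_ltn_trans (leq_subr i m) mn).
Qed.

Lemma fps_mulC a b : fps_mul a b =1 fps_mul b a.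
Proof. by move=> m; rewrite !(@fps_mulE m.+1) // mulrC. Qed.

Lemma fps_mulA a b c : fps_mul a (fps_mul b c) =1 fps_mul (fps_mul a b) c.
Proof.
move=> m; pose t x := \poly_(i < m.+1) x i : {poly K}.
have eq_tr x y : fps_mul x y m = (t x * t y)`_m by apply: fps_mulE.
transitivity ((t a * (t b * t c))`_m); last first.
  rewrite mulrA [RHS]/fps_mul coefM; apply: eq_bigr => -[i /= im] _.
  rewrite coef_poly (leq_ltn_trans (leq_subr i m)) // -(fps_mulE a b im).
  by rewrite (@fps_mulE m.+1).
rewrite [LHS]/fps_mul coefM; apply: eq_bigr => -[i /= im] _.
by rewrite coef_poly im (@fps_mulE m.+1) // (leq_ltn_trans (leq_subr i m)).
Qed.

Lemma eq_fps_mul a b c d : a =1 b -> c =1 d -> fps_mul a c =1 fps_mul b d.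
Proof. by move=> h h' n; apply: eq_bigr => i _; rewrite h h'. Qed.

Lemma fps_mul1 a : fps_mul (fun n => (n == 0%N)%:R) a =1 a.
Proof.
move=> n; rewrite /fps_mul big_ord_recl /= mul1r subn0 big1 ?addr0 // => i _.
by rewrite mul0r.
Qed.

Lemma fps_mul0 a b : fps_mul a b 0%N = a 0%N * b 0%N.
Proof. by rewrite /fps_mul big_ord1. Qed.

Lemma fps_inv0 a : a 0%N != 0 -> fps_inv a 0%N = (a 0%N)^-1.
Proof.
by move=> a0; have := fps_mulV a0 0%N; rewrite fps_mul0 => h;
   apply: (mulfI a0); rewrite h mulfV.
Qed.

Lemma fps_divK a b : b 0%N != 0 -> fps_mul b (fps_div a b) =1 a.
Proof.
move=> b0 n; rewrite /fps_div fps_mulC -fps_mulA -[RHS]fps_mul1 fps_mulC.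
by apply: eq_fps_mul => // m; rewrite fps_mulC fps_mulV.
Qed.

Lemma fps_div_uniq a b c : b 0%N != 0 -> fps_mul b c =1 a -> c =1 fps_div a b.
Proof.
move=> b0 h n; rewrite -[LHS]fps_mul1 /fps_div.
rewrite -(eq_fps_mul (fps_mulV b0) (fun _ => erefl)).
rewrite (eq_fps_mul (fps_mulC b _) (fun _ => erefl)) -fps_mulA fps_mulC.
by apply: eq_fps_mul.
Qed.

Lemma fps_div_cross a b c d : b 0%N != 0 -> d 0%N != 0 ->
  fps_div a b =1 fps_div c d ->
  fps_mul (fps_div d b) b =1 d /\ fps_mul (fps_div d b) a =1 c.
Proof.
move=> b0 d0 h; split=> n; first by rewrite fps_mulC fps_divK.
rewrite -[RHS](fps_divK (b := d) c d0) /fps_div -fps_mulA.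
apply: eq_fps_mul => // m; rewrite fps_mulC; exact: h.
Qed.

End PowerSeriesTheory.

(* The coefficient of [u^m] in the series in [u^-1] ([b = false]), resp. in [u]
   ([b = true]), with coefficients [a]. *)
Definition ext (K : fieldType) (b : bool) (a : nat -> K) (m : int) : K :=
  if inr b m then a `|m|%N else 0.

(** * Rescaling by scalar series *)

Section Twist.
Variables (K : fieldType) (V : lmodType K) (p p' : K).
Variables (T : bool -> opser V) (hT : rtt_sys p p' T).
Variable f : bool -> nat -> K.

Let lin b i j m : linear (T b i j m) := @sys_lin _ _ _ _ _ hT b i j m.

Definition sh (b : bool) (s : nat) : int := if b then - Posz s else Posz s.

(** The product with the first [N] terms of the scalar series f_b: a finite sum, so that the
    relations follow from [rel_linl] and [rel_linr]. The full product [twist] agrees with it in any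
    fixed exponent once [N] is large. *)
Definition part (N : nat) (b : bool) : opser V := fun i j m w =>
  \sum_(s < N) f b s *: T b i j (m + sh b s) w.

Definition twist (b : bool) : opser V := fun i j m w => part `|m|%N.+1 b i j m w.

Lemma part_lin N b : lin_ser (part N b).
Proof.
move=> i j m a v w; rewrite /part scaler_sumr -big_split; apply: eq_bigr => s _.
by rewrite lin scalerDr !scalerA mulrC.
Qed.

Lemma twist_lin b : lin_ser (twist b).
Proof. by move=> i j m; exact: part_lin. Qed.

Lemma twist_part N b i j m w : (`|m| < N)%N -> twist b i j m w = part N b i j m w.
Proof.
move=> hN; rewrite /twist /part (big_ord_widen _ (fun s => f b s *: T b i j (m + sh b s) w) hN).
rewrite big_mkcond /=; apply: eq_bigr => s _; case: ifP => // hs.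
rewrite (sys_supp hT) ?scaler0 //; move: hs; rewrite /inr /sh; case: b; lia.
Qed.

Lemma twist_supp b i j m w : ~~ inr b m -> twist b i j m w = 0.
Proof.
move=> hm; rewrite /twist /part big1 // => s _; rewrite (sys_supp hT) ?scaler0 //.
by move: hm; rewrite /inr /sh; case: b; lia.
Qed.

Lemma part_recr N b i j m w : part N.+1 b i j m w =
  f b N *: T b i j (m + sh b N) w + part N b i j m w.
Proof. by rewrite /part big_ord_recr /= addrC. Qed.

Lemma rel_partl N b B : lin_ser B -> Rel p p' (T b) B -> Rel p p' (part N b) B.
Proof.
move=> hB hR; elim: N => [|N IH] i j k l m n w.
  have := @rel_zerol _ _ p p' B hB i j k l m n w.
  by rewrite /part !big_ord0.
by have := @rel_linl _ _ _ _ _ _ _ hB (f b N) (sh b N) hR IH i j k l m n w; rewrite !part_recr.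
Qed.

Lemma rel_partr N b A : lin_ser A -> Rel p p' A (T b) -> Rel p p' A (part N b).
Proof.
move=> hA hR; elim: N => [|N IH] i j k l m n w.
  have := @rel_zeror _ _ p p' A hA i j k l m n w.
  by rewrite /part !big_ord0.
by have := @rel_linr _ _ _ _ _ _ _ hA (f b N) (sh b N) hR IH i j k l m n w; rewrite !part_recr.
Qed.

Lemma twist_sys : rtt_sys p p' twist.
Proof.
split=> [b||b b' bb]; [exact: twist_lin | exact: twist_supp |].
(* One instance of the relation involves only the exponents m, m - 1, n and n - 1, whose absolute
   values are below this bound. *)
move=> i j k l m n w; pose N := (`|m| + `|n|).+2.
have hR := @rel_partl N b _ (part_lin N b')
  (@rel_partr N b' _ (sys_lin hT b) (sys_rel hT bb)) i j k l m n w.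
have e b0 i0 j0 m0 : (`|m0| < N)%N -> twist b0 i0 j0 m0 = part N b0 i0 j0 m0.
  by move=> h; apply: boolp.funext => v; exact: twist_part.
by rewrite !e //; rewrite /N; lia.
Qed.

Lemma twist_ext b i m z (a : nat -> K) :
  (forall m, T b i i m z = ext b a m *: z) ->
  twist b i i m z = ext b (fps_mul (f b) a) m *: z.
Proof.
move=> h; have [hm|hm] := boolP (inr b m); last by rewrite twist_supp // /ext (negbTE hm) scale0r.
rewrite /ext hm /twist /part /fps_mul scaler_suml; apply: eq_bigr => -[s /= hs] _.
have [e1 e2] : inr b (m + sh b s) /\ `|(m + sh b s)%R|%N = (`|m| - s)%N.
  by move: hm; rewrite /inr /sh; case: (b) => /= hm; split; lia.
by rewrite h scalerA /ext e1 e2.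
Qed.

Lemma twist_12 b z : (forall m, T b false true m z = 0) ->
  forall m, twist b false true m z = 0.
Proof. by move=> h m; apply: big1 => s _; rewrite h scaler0. Qed.

(** The passage from [T] to [twist] is triangular in the exponent with diagonal entries [f b 0],
    hence is inverted by induction on the absolute value of [m]. *)
Lemma untwist_stable S : (forall b, f b 0%N != 0) -> subsp S ->
  stable twist S -> stable T S.
Proof.
move=> f0 hS h b i j m w hw.
have [n] := ubnP `|m|%N; elim: n m => // n IH m hm.
have [r|r] := boolP (inr b m); last by rewrite (sys_supp hT) //; exact: hS.1.
have := h b i j m w hw; rewrite /twist /part big_ord_recl /= => h1.
apply: (subspZE hS (f0 b)); rewrite (_ : m = m + sh b 0); last by rewrite /sh; case: (b); lia.
rewrite -[X in S X](addrK (\sum_(s < `|m|%N) f b (bump 0 s) *: T b i j (m + sh b (bump 0 s)) w)).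
apply: (subspB hS h1); apply: (subsp_sum hS) => -[s /= hs] _.
by apply: (subspZ hS); apply: IH; rewrite /bump /sh; move: r; rewrite /inr; case: (b); lia.
Qed.

End Twist.

(** * Finite dimension gives rational weights *)

Lemma sum_widen (K : nmodType) (F : nat -> K) (M N : nat) : (M <= N)%N ->
  (forall i, (M <= i)%N -> F i = 0) -> \sum_(i < N) F i = \sum_(i < M) F i.
Proof.
move=> MN hF; rewrite (big_ord_widen N F MN) [RHS]big_mkcond.
by apply: eq_bigr => i _; case: ifP => // /negbT; rewrite -leqNgt => /hF.
Qed.

Lemma lin_dep (K : fieldType) (V : lmodType K) n (e : 'I_n -> V) (x : nat -> V) :
  (forall v, exists c : 'I_n -> K, v = \sum_(i < n) c i *: e i) ->
  exists2 a : 'rV[K]_n.+1, a != 0 & \sum_(i < n.+1) a 0 i *: x i = 0.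
Proof.
move=> he; have [c hc] := boolp.choice (fun i : 'I_n.+1 => he (x i)).
pose M := \matrix_(i < n.+1, j < n) c i j.
have : kermx M != 0.
  by rewrite kermx_eq0; apply/negP => /eqP h; have := rank_leq_col M; rewrite h ltnn.
case/rowV0Pn => a /sub_kermxP ha a0; exists a => //.
transitivity (\sum_(i < n.+1) \sum_(j < n) (a 0 i * c i j) *: e j).
  apply: eq_bigr => i _; rewrite hc scaler_sumr.
  by apply: eq_bigr => j _; rewrite scalerA.
rewrite exchange_big /=; apply: big1 => j _; rewrite -scaler_suml.
have /matrixP/(_ 0 j) := ha; rewrite !mxE => h.
suff -> : \sum_i a 0 i * c i j = 0 by rewrite scale0r.
by rewrite -[RHS]h; apply: eq_bigr => i _; rewrite mxE.
Qed.

(** * Two-sided recurrences and rational functions *)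

Section Recurrence.
Variable K : fieldType.
Implicit Types (E : int -> K) (A : {poly K}).

(** This is A(u) E(u) = 0, with E(u) a two-sided formal series. *)
Definition annihilates A E := forall m : int,
  \sum_(i < size A) A`_i * E (m - Posz i) = 0.

Lemma annihilatesP A E : annihilates A E -> forall M m, (size A <= M)%N ->
  \sum_(i < M) A`_i * E (m - Posz i) = 0.
Proof.
move=> h M m hM; rewrite -[RHS](h m).
by apply: (sum_widen (F := fun i => A`_i * E (m - Posz i)) hM) => i hi;
   rewrite nth_default // mul0r.
Qed.

Lemma annihilates_widen A E M : (size A <= M)%N ->
  (forall m, \sum_(i < M) A`_i * E (m - Posz i) = 0) -> annihilates A E.
Proof.
move=> hM h m; rewrite -[RHS](h m); symmetry.
by apply: (sum_widen (F := fun i => A`_i * E (m - Posz i)) hM) => i hi;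
   rewrite nth_default // mul0r.
Qed.

(** Multiplication by u is invertible on two-sided series, so powers of u can be divided out of
    [A]. *)
Lemma annihilates_coef0 A E : A != 0 -> annihilates A E ->
  exists A', A'`_0 != 0 /\ annihilates A' E.
Proof.
elim/poly_ind: A => [|A c IH]; first by rewrite eqxx.
have [-> |c0] := eqVneq c 0; last first.
  move=> _ h; exists (A * 'X + c%:P); split=> //.
  by rewrite coefD coefMX coefC add0r.
rewrite addr0 mulf_eq0 polyX_eq0 orbF => A0 h; apply: IH => // m.
have := h (m + 1); rewrite size_mulX // big_ord_recl /= coefMX mul0r add0r => e.
rewrite -[RHS]e; apply: eq_bigr => i _; rewrite coefMX /=; congr (_ * E _).
by rewrite /bump /=; lia.
Qed.

Lemma annihilatesZ a A E : annihilates A E -> annihilates (a *: A) E.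
Proof.
move=> h; apply: (@annihilates_widen _ _ (size A)); first exact: size_scale_leq.
move=> m; under eq_bigr do rewrite coefZ -mulrA.
by rewrite -mulr_sumr h mulr0.
Qed.

Variables (c cb : nat -> K).

Definition two_ser (m : int) : K := ext true cb m - ext false c m.

Variables (A : {poly K}) (k : nat).
Hypotheses (sA : size A = k.+1) (hA : annihilates A two_ser).

(** The common value of A cb and A c: the first product has no negative exponents, the second none
    above [k], so their equality makes both a polynomial. *)
Definition num := \poly_(n < k.+1) fps_mul (fps_at0 A) cb n.

Lemma ann_eq M m : (k < M)%N -> \sum_(i < M) A`_i * ext true cb (m - Posz i) =
  \sum_(i < M) A`_i * ext false c (m - Posz i).
Proof.
move=> hM; apply/eqP; rewrite -subr_eq0 -sumrB; apply/eqP.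
have hs : (size A <= M)%N by rewrite sA.
rewrite -[RHS](annihilatesP hA m hs); apply: eq_bigr => i _.
by rewrite /two_ser mulrBr.
Qed.

Lemma sum_at0 (n M : nat) : (n < M)%N ->
  \sum_(i < M) A`_i * ext true cb (Posz n - Posz i) = fps_mul (fps_at0 A) cb n.
Proof.
move=> hM.
rewrite (sum_widen (F := fun i => A`_i * ext true cb (Posz n - Posz i)) hM).
  apply: eq_bigr => -[i /= hi] _; rewrite /ext ifT; last by rewrite /inr; lia.
  by rewrite /fps_at0; congr (_ * cb _); lia.
by move=> i hi; rewrite /ext ifF ?mulr0 // /inr; apply/negP; lia.
Qed.

(** This is the coefficient of u^(k - r) in A(u) c(u). Reversing the index of summation matches
    [fps_atoo]; [F] pads both sums to one range. *)
Lemma sum_atoo r : \sum_(i < k.+1) A`_i * ext false c (Posz k - Posz r - Posz i) =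
  fps_mul (fps_atoo k A) c r.
Proof.
pose F j := fps_atoo k A j * ext false c (Posz j - Posz r).
transitivity (\sum_(j < k.+1 + r.+1) F j).
  rewrite (sum_widen (F := F) (leq_addr _ _)); last first.
    by move=> i hi; rewrite /F /fps_atoo leqNgt hi mul0r.
  rewrite (reindex_inj rev_ord_inj); apply: eq_bigr => -[j /= hj] _.
  by rewrite /F /fps_atoo -ltnS hj subSS; congr (_ * ext _ _ _); lia.
rewrite (sum_widen (F := F) (leq_addl _ _)); last first.
  by move=> i hi; rewrite /F /ext ifF ?mulr0 // /inr; apply/negP; lia.
apply: eq_bigr => -[j /= hj] _; rewrite /F /ext ifT; last by rewrite /inr; lia.
by congr (_ * c _); lia.
Qed.

Lemma num_at0 : fps_mul (fps_at0 A) cb =1 fps_at0 num.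
Proof.
move=> n; rewrite /fps_at0 coef_poly; case: ltnP => // kn.
rewrite -(sum_at0 (ltnSn n)) ann_eq //; last by rewrite ltnS ltnW.
rewrite big1 // => -[i /= hi] _.
have [ik|ki] := ltnP k i; first by rewrite nth_default ?mul0r // sA.
by rewrite /ext ifF ?mulr0 // /inr; apply/negP; lia.
Qed.

Lemma num_atoo : fps_mul (fps_atoo k A) c =1 fps_atoo k num.
Proof.
move=> r; rewrite -sum_atoo -ann_eq // /fps_atoo; case: leqP => rk.
  rewrite coef_poly ltnS leq_subr -(@sum_at0 _ k.+1); last by rewrite ltnS leq_subr.
  by apply: eq_bigr => i _; congr (_ * ext _ _ (_ - _)); lia.
by rewrite big1 // => i _; rewrite /ext ifF ?mulr0 // /inr; apply/negP; lia.
Qed.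

Hypotheses (ccb : c 0%N * cb 0%N = 1) (nA : lead_coef A * A`_0 = 1).

(** Comparing extreme coefficients gives num_k = A_k c_0 and num_0 = A_0 cb_0. Their product is 1,
    which also shows that the degree does not drop. *)
Lemma num_spec : [/\ size num = k.+1, lead_coef num * num`_0 = 1,
  c =1 fps_div (fps_atoo k num) (fps_atoo k A)
  & fps_div (fps_at0 num) (fps_at0 A) =1 cb].
Proof.
have lA : lead_coef A = A`_k by rewrite lead_coefE sA.
have nk : num`_k = A`_k * c 0%N.
  by have := num_atoo 0%N; rewrite fps_mul0 /fps_atoo leq0n subn0 => <-.
have n0 : num`_0 = A`_0 * cb 0%N.
  by have := num_at0 0%N; rewrite fps_mul0.
have e : num`_k * num`_0 = 1.
  by rewrite nk n0 mulrACA -lA nA ccb mulr1.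
have Ak0 : A`_k * A`_0 != 0 by rewrite -lA nA oner_eq0.
have sn : size num = k.+1.
  apply/eqP; rewrite eqn_leq size_poly /= ltnNge; apply/negP => h.
  by move: e; rewrite nth_default // mul0r => /eqP; rewrite eq_sym oner_eq0.
split=> //; first by rewrite lead_coefE sn.
  apply: fps_div_uniq; last exact: num_atoo.
  by rewrite /fps_atoo leq0n subn0; apply: contraNneq Ak0 => ->; rewrite mul0r.
move=> n; apply/esym; move: n; apply: fps_div_uniq; last exact: num_at0.
by rewrite /fps_at0; apply: contraNneq Ak0 => ->; rewrite mulr0.
Qed.

End Recurrence.

(** * An annihilating polynomial from a linear dependence *)

Section Necessity.
Variables (K : fieldType) (V : lmodType K) (p p' : K).
Hypothesis pnp' : p != p'.
Variables (T : bool -> opser V) (hT : rtt_sys p p' T).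
Variables (z : V) (c cb : nat -> K).
Hypotheses (z0 : z != 0) (hz12 : forall b m, T b false true m z = 0).
Hypothesis hz1 : forall b m, T b false false m z = ext b (if b then cb else c) m *: z.
Hypothesis hz2 : forall b m, T b true true m z = (m == 0)%:R *: z.

Let lin b i j m : linear (T b i j m) := @sys_lin _ _ _ _ _ hT b i j m.
Let D := defect T 0.
Let E := two_ser c cb.
Let Dlin : lin_ser D := @defect_lin _ _ _ _ _ hT 0.

Lemma D11 m : D false false m z = E m *: z.
Proof.
by rewrite /D /defect !hz1 oppr0 addr0 /E /two_ser; module_simpl; ring.
Qed.

Lemma D22 m : D true true m z = 0.
Proof. by rewrite /D /defect !hz2 oppr0 addr0 scaleN1r addNr. Qed.

Lemma D12 m : D false true m z = 0.
Proof. by rewrite /D /defect !hz12 scaler0 addr0. Qed.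

(* With [pair_pos]: [(t_12 - \bar t_12)(v)] pairs with [D_21(u) zeta] to a
   two-sided Toeplitz array, whatever the signs of the exponents. *)
Lemma pair_neg (a : nat) n :
  T false false true (- Posz a.+1) (D true false n z) = (- (p - p') * E (n - Posz a.+1)) *: z.
Proof.
pose G m n := T false false true m (D true false n z).
(* [G] depends on m + n only, except for a jump between m = 0 and m = -1. It vanishes for m = 1,
   hence for m = 0, and the jump gives its values for m < 0. *)
have h m n1 : G m (n1 - 1) - G (m - 1) n1 = ((p - p') * ((m == 0)%:R * E (n1 - 1))) *: z.
  have := rel1221 (rel_T_defect hT 0) m n1 z.
  rewrite -/D !scale1r -/(G _ _) -/(G _ _) => ->.
  rewrite hz12 hz12 D11 hz1 !(linZ (@Dlin _ _ _)) D22 !(lin0 (@Dlin _ _ _)).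
  rewrite (linZ (@lin _ _ _ _)) hz2 !(subrr, oppr0, add0r, scaler0, subr0) !scalerA.
  by rewrite [E _ * _]mulrC.
have G1 y : G 1 y = 0 by apply: (sys_supp hT).
have G0 y : G 0 y = 0.
  have := h 1 y; rewrite G1 subrr mul0r mulr0 scale0r sub0r => /eqP.
  by rewrite oppr_eq0 => /eqP.
rewrite -/(G _ _); elim: a n => [|a IH] n.
  have := h 0 n; rewrite G0 eqxx mul1r !sub0r => e.
  by rewrite mulNr scaleNr -e opprK.
have := h (- Posz a.+1) n; rewrite IH oppr_eq0 mul0r mulr0 scale0r => /eqP.
rewrite subr_eq0 => /eqP; rewrite (_ : - Posz a.+1 - 1 = - Posz a.+2); last by lia.
by move=> <-; congr ((_ * E _) *: z); lia.
Qed.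

Lemma pair_pos (a : nat) n :
  T true false true (Posz a) (D true false n z) = ((p - p') * E (n + Posz a)) *: z.
Proof.
pose H m n := T true false true n (D true false m z).
(* Likewise [H] vanishes at n = -1 and jumps only on entering n = 0. *)
have h m n1 : H m (n1 - 1) - H (m - 1) n1 =
    (- (p - p') * ((n1 == 0)%:R * E (m - 1))) *: z.
  have := rel2112 (rel_defect_T hT 0) m n1 z.
  rewrite -/D !scale1r -/(H _ _) -/(H _ _) => ->.
  rewrite hz12 hz12 !(lin0 (@Dlin _ _ _)) D22 (lin0 (@lin _ _ _ _)).
  rewrite hz2 (linZ (@Dlin _ _ _)) D11 !(subrr, oppr0, sub0r, subr0).
  by rewrite !scalerA -scaleNr addr0 !scalerA.
have Hm y : H y (-1) = 0 by apply: (sys_supp hT).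
rewrite -/(H _ _); elim: a n => [|a IH] n.
  have := h (n + 1) 0; rewrite sub0r Hm eqxx mul1r addrK sub0r addr0 => e.
  by rewrite -[LHS]opprK e -scaleNr mulNr opprK.
have := h (n + 1) (Posz a.+1); rewrite (_ : Posz a.+1 - 1 = Posz a); last by lia.
rewrite IH addrK mul0r mulr0 scale0r => /eqP; rewrite subr_eq0 => /eqP <-.
by congr ((_ * E _) *: z); lia.
Qed.

(** Applying the coefficient of v^m of \bar t_12 for m >= 0, or of t_12 for m < 0, to a dependence
    between the D_21 coefficients on [z] gives one recurrence for [E], valid at every integer m. *)
Lemma finite_dim_annihilates : finite_dim V ->
  exists A : {poly K}, A != 0 /\ annihilates A E.
Proof.
case=> d [e he].
have [a a0 ha] := lin_dep (fun i => D true false (Posz i) z) he.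
have kk : p - p' != 0 by rewrite subr_eq0.
have rec m : \sum_(i < d.+1) a 0 i * E (Posz i + m) = 0.
  have fin b kappa : kappa != 0 ->
      (forall i, T b false true m (D true false i z) = (kappa * E (i + m)) *: z) ->
      \sum_(i < d.+1) a 0 i * E (Posz i + m) = 0.
    move=> k0 h; have := congr1 (T b false true m) ha.
    rewrite (lin0 (@lin _ _ _ _)) (lin_sum (@lin _ _ _ _)).
    rewrite (eq_bigr (fun i : 'I_d.+1 => (kappa * (a 0 i * E (Posz i + m))) *: z)).
      rewrite -scaler_suml -mulr_sumr => /eqP.
      by rewrite scaler_eq0 (negbTE z0) orbF mulf_eq0 (negbTE k0) => /eqP.
    by move=> i _; rewrite (linZ (@lin _ _ _ _)) h scalerA mulrCA.
  have [hm|hm] := leP 0 m.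
    apply: (fin true _ kk) => i.
    by have := pair_pos `|m|%N i; rewrite (_ : Posz `|m|%N = m) //; lia.
  apply: (fin false (- (p - p'))) => [|i]; first by rewrite oppr_eq0.
  have := pair_neg `|m|%N.-1 i.
  by rewrite (_ : - Posz (`|m|%N.-1).+1 = m) //; lia.
(* The coefficients are reversed because the recurrence has E(i + m) where [annihilates] has E(m -
   i). *)
pose A := \poly_(i < d.+1) a 0 (inord (d - i)).
exists A; split.
  apply: contraNneq a0 => hA; apply/eqP/rowP => i; rewrite mxE.
  have := congr1 (fun P : {poly K} => P`_(d - i)) hA; rewrite coef0 coef_poly ltnS leq_subr.
  have id : (i <= d)%N by rewrite -ltnS.
  by rewrite subKn // inord_val.
apply: (@annihilates_widen _ _ _ d.+1); first exact: size_poly.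
move=> m; rewrite -[RHS](rec (m - Posz d)) (reindex_inj rev_ord_inj).
apply: eq_bigr => -[j /= hj] _; rewrite coef_poly subSS ltnS leq_subr.
rewrite subKn //; congr (a 0 _ * E _); last by lia.
by apply: val_inj; rewrite /= inordK.
Qed.

End Necessity.

(** * The quantum affine superalgebra *)

Lemma malgU_scale (K : fieldType) (G : choiceType) (c : K) (k : {fmonom G}) :
  << c *g k >> = c *: << k >> :> {malg K[{fmonom G}]}.
Proof. by rewrite -mul_malgC malgM_def fgmulUU mulr1 mul1m. Qed.

Lemma malgU_cons (K : fieldType) (G : choiceType) (g : G) (l : seq G) :
  << FMonom (g :: l) >> = freegen K g * << FMonom l >> :> {malg K[{fmonom G}]}.
Proof.
rewrite /freegen malgM_def fgmulUU mulr1; congr << _ *g _ >>.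
by apply: val_inj; rewrite /= fmM fmU.
Qed.

Lemma malgU_nil (K : fieldType) (G : choiceType) :
  << FMonom [::] >> = 1 :> {malg K[{fmonom G}]}.
Proof. by congr << _ *g _ >>; apply: val_inj; rewrite /= fm1. Qed.

Section Action.
Variables (K : fieldType) (G : choiceType) (par : G -> bool).
Variables (rel : {malg K[{fmonom G}]} -> Prop) (V : superrep par rel).
Implicit Types (x y : {malg K[{fmonom G}]}) (v : V).

Definition ract x (v : V) : V := act (palg_pi rel x) v.

Lemma ractD x y v : ract (x + y) v = ract x v + ract y v.
Proof.
rewrite /ract palg_piD -[palg_pi _ x in LHS]scale1r.
by rewrite act_linearl scale1r.
Qed.
Lemma ract0 v : ract 0 v = 0.
Proof. by apply: (@addrI _ (ract 0 v)); rewrite -ractD !addr0. Qed.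
Lemma ractN x v : ract (- x) v = - ract x v.
Proof. by apply/eqP; rewrite -addr_eq0 -ractD addNr ract0. Qed.
Lemma ractZ a x v : ract (a *: x) v = a *: ract x v.
Proof.
have := act_linearl v a (palg_pi rel x) (palg_pi rel 0).
rewrite -/(ract 0 v) ract0 addr0 -/(ract x v) => <-.
rewrite -[a *: palg_pi rel x]/(palg_scale a (palg_pi rel x)) palg_piZ -palg_piD.
by rewrite addr0.
Qed.
Lemma ractM x y v : ract (x * y) v = ract x (ract y v).
Proof. by rewrite /ract -actM -[_ * palg_pi _ _]/(palg_mul _ _) palg_piM. Qed.
Lemma ract1 v : ract 1 v = v.
Proof. exact: act1. Qed.
Lemma ract_lin x : linear (ract x).
Proof. exact: act_linearr. Qed.
Lemma ract_rel x v : rel x -> ract x v = 0.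
Proof.
move=> h; rewrite -(ract0 v) /ract; congr act; apply/palg_piP.
by rewrite subr0; exact: ideal_rel.
Qed.

(** Every element is a linear combination of words in the generators. *)
Lemma ract_stable (S : V -> Prop) : subsp S ->
  (forall g v, S v -> S (ract (freegen K g) v)) ->
  forall (x : palg rel) v, S v -> S (act x v).
Proof.
move=> hS hg x v hv; elim/palg_ind: x => x; rewrite -/(ract x v) [x]monalgE.
elim/big_rec: _ => [|k y _ hy]; first by rewrite ract0; exact: hS.1.
rewrite ractD; apply: (subspD hS) => //; rewrite malgU_scale ractZ.
apply: (subspZ hS); case: k => l.
elim: l => [|g l IH]; first by rewrite malgU_nil ract1.
by rewrite malgU_cons ractM; exact: hg.
Qed.

Definition parity_op (v : V) : V := (v.1, - v.2).

Lemma parity_lin : linear parity_op.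
Proof.
move=> a v w; congr pair; transitivity (a *: (- v.2) + - w.2) => //.
by rewrite scalerN -opprD.
Qed.

Lemma parity_gen g v : parity_op (ract (freegen K g) v) =
  (if par g then -1 else 1) *: ract (freegen K g) (parity_op v).
Proof.
have hom p w : homog p w -> homog (par g (+) p) (ract (freegen K g) w).
  apply: act_homog; exists (freegen K g) => // m.
  rewrite /freegen mcoeffU; have [<- _|_] := eqVneq (fmu g) m; last by rewrite mulr0n eqxx.
  by rewrite /word_parity fmU /= addn0; case: (par g).
have hv : v = ((v.1, 0) : V) + ((0, v.2) : V).
  by rewrite {1}[v]surjective_pairing; congr pair; rewrite /= ?addr0 ?add0r.
have hpv : parity_op v = ((v.1, 0) : V) - ((0, v.2) : V).
  by congr pair; rewrite /= ?oppr0 ?addr0 ?sub0r.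
have hom_op p w : homog p w -> parity_op w = (if p then -1 else 1) *: w.
  rewrite /homog /parity_op; case: p => h; rewrite ?scaleN1r ?scale1r.
    by congr pair; rewrite h oppr0.
  by rewrite [RHS]surjective_pairing h oppr0.
rewrite {1}hv hpv (linD (@ract_lin _)) (linB (@ract_lin _)) (linD parity_lin).
have h0 : homog false ((v.1, 0) : V) by [].
have h1 : homog true ((0, v.2) : V) by [].
rewrite (hom_op _ _ (hom _ _ h0)) (hom_op _ _ (hom _ _ h1)) addbF addbT.
by case: (par g); rewrite /= ?scaleN1r ?scale1r ?opprB // addrC.
Qed.

End Action.

Lemma span_mem_finite_dim (K : fieldType) (V : lmodType K) (L : seq V) :
  (forall v, span (fun w => w \in L) v) -> finite_dim V.
Proof.
move=> h; exists (size L), (fun i => L`_i) => v; move: v (h v).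
apply: span_sub.
  split=> [|a v w [c ->] [d ->]].
    by exists (fun => 0); rewrite big1 // => i _; rewrite scale0r.
  exists (fun i => a * c i + d i); rewrite scaler_sumr -big_split.
  by apply: eq_bigr => i _; rewrite scalerDl scalerA.
move=> w hw; have hi : (index w L < size L)%N by rewrite index_mem.
exists (fun i => (i == Ordinal hi)%:R); rewrite (bigD1 (Ordinal hi)) //= eqxx scale1r.
by rewrite nth_index // big1 ?addr0 // => i /negbTE ->; rewrite scale0r.
Qed.

Lemma ext_eq (K : fieldType) b (a a' : nat -> K) : a =1 a' -> ext b a =1 ext b a'.
Proof. by move=> h m; rewrite /ext h. Qed.

Definition idx (i : bool) : 'I_2 := if i then idx2 else idx1.

Lemma idxP (i : 'I_2) : exists b, i = idx b.
Proof.
by case: i => [[|[|//]] hi]; [exists false | exists true]; apply: val_inj.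
Qed.

Section AlgebraAction.
Variables (K : fieldType) (A : lalgType K) (W : lmodType K) (phi : A -> W -> W).
Hypotheses (phiD : forall x y w, phi (x + y) w = phi x w + phi y w)
  (phiN : forall x w, phi (- x) w = - phi x w)
  (phiZ : forall a x w, phi (a *: x) w = a *: phi x w)
  (phiM : forall x y w, phi (x * y) w = phi x (phi y w)).

Lemma phi_rel (a1 a2 a3 a4 a5 a6 b1 b2 b3 b4 : K) x1 x2 x3 x4 x5 x6 x7 x8
    y1 y2 y3 y4 y5 y6 y7 y8 w :
  phi (((a1 *: (x1 * y1) - a2 *: (x2 * y2)) - a3 *: (a4 *: (x3 * y3) - a5 *: (x4 * y4)))
    - a6 *: ((b1 *: (x5 * y5) + b2 *: (x6 * y6)) - (b3 *: (x7 * y7) + b4 *: (x8 * y8)))) w = 0 ->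
  (a1 *: phi x1 (phi y1 w) - a2 *: phi x2 (phi y2 w))
  - a3 *: (a4 *: phi x3 (phi y3 w) - a5 *: phi x4 (phi y4 w)) =
  a6 *: ((b1 *: phi x5 (phi y5 w) + b2 *: phi x6 (phi y6 w))
  - (b3 *: phi x7 (phi y7 w) + b4 *: phi x8 (phi y8 w))).
Proof.
rewrite phiD phiN => /eqP; rewrite subr_eq0 => /eqP.
have phiB x y v : phi (x - y) v = phi x v - phi y v by rewrite phiD phiN.
have phiL a x y v : phi (a *: (x * y)) v = a *: phi x (phi y v) by rewrite phiZ phiM.
by rewrite phiB phiB !phiL phiZ phiB !phiL phiZ phiB phiD !phiL phiD !phiL.
Qed.

End AlgebraAction.

Section PresentedRelations.
Variables (K : fieldType) (q : K) (s : 2.-tuple bool).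
Hypothesis hs : s = [tuple false; true] \/ s = [tuple true; false].

Notation p := (qi q s idx1).
Notation p' := (qi q s idx2).

Lemma qi2E : p' = p^-1.
Proof. by rewrite /qi /ipar; case: hs => ->; rewrite !(tnth_nth false) /= ?invrK. Qed.

(** The shift [c] cancels in |i| + |j|, so the signs in the relations are the same for both choices
    of [s]. *)
Lemma ipar_idx : exists c, forall i, ipar s (idx i) = i (+) c.
Proof.
case: hs => ->; [exists false | exists true];
  by case; rewrite /ipar (tnth_nth false).
Qed.

Variables (W : lmodType K) (phi : {malg K[{fmonom Ugen}]} -> W -> W).
Hypotheses (phiD : forall x y w, phi (x + y) w = phi x w + phi y w)
  (phiN : forall x w, phi (- x) w = - phi x w)
  (phiZ : forall a x w, phi (a *: x) w = a *: phi x w)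
  (phiM : forall x y w, phi (x * y) w = phi x (phi y w)).

Lemma rtt_rel b b' :
  (forall i j k l m n w, phi (rtt_lhs q s b b' i j k l m n - rtt_rhs q s b b' i j k l m n) w = 0) ->
  Rel p p' (fun i j m w => phi (tcoef K b (idx i) (idx j) m) w)
    (fun i j m w => phi (tcoef K b' (idx i) (idx j) m) w).
Proof.
move=> h; have [c hc] := ipar_idx.
have sgE i j k l : ssign K s (idx i) (idx j) (idx k) (idx l) = sg K i j k l.
  rewrite /ssign !hc /sg; case: (c); case: i; case: j; case: k; case: l => //=;
  by rewrite ?expr0 ?expr1.
have qE i : qi q s (idx i) = qq p p' i by case: i.
have qvE i : (qq p p' i)^-1 = qv p p' i by case: i; rewrite /= qi2E ?invrK.
have qvif (i k : bool) : qi q s (idx i) ^- (idx i == idx k) = oif (i == k) (qv p p' i).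
  by rewrite qE -qvE /oif; case: i; case: k; rewrite /= ?expr1 ?expr0 ?invr1.
have qqif (i k : bool) : qi q s (idx i) ^+ (idx i == idx k) = oif (i == k) (qq p p' i).
  by rewrite qE /oif; case: i; case: k; rewrite /= ?expr1 ?expr0.
have vifE (i k : bool) v : (idx k < idx i)%N%:R *: v = vif (~~ k && i) v :> W.
  by case: i; case: k; rewrite /= ?scale1r ?scale0r.
move=> i j k l m n w; have := phi_rel phiD phiN phiZ phiM (h (idx i) (idx j) (idx k) (idx l) m n w).
by rewrite !vifE !qvif !qqif !sgE !qE !qvE.
Qed.

End PresentedRelations.

(** * From representations to systems of operator series *)

Section Interface.
Variables (K : fieldType) (q : K) (s : 2.-tuple bool) (V : Urep q s).
Hypothesis hs : s = [tuple false; true] \/ s = [tuple true; false].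

Notation p := (qi q s idx1).
Notation p' := (qi q s idx2).

Definition Tgen (b : bool) : opser V := fun i j m w =>
  ract (V := V) (tcoef K b (idx i) (idx j) m) w.

Lemma Tgen_sys : rtt_sys p p' Tgen.
Proof.
split=> [b i j m|b i j m w hm|b b' bb].
- exact: ract_lin.
- by rewrite /Tgen /tcoef -[X in if X then _ else _]/(inr b m) (negbTE hm) ract0.
apply: rtt_rel => //.
- exact: ractD.
- exact: ractN.
- exact: ractZ.
- exact: ractM.
move=> i j k l m n w; apply: ract_rel; apply: Urel_rtt.
by case: b b' bb => [] [].
Qed.

Lemma Tgen_out b i j m w : ~~ inr b m -> Tgen b i j m w = 0.
Proof. exact: (sys_supp Tgen_sys). Qed.

Lemma Tgen_act b i j r w : Tgen b i j (sh (~~ b) r) w = act (tgen q s b (idx i) (idx j) r) w.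
Proof.
rewrite /Tgen /tcoef /sh; case: b => /=.
  by rewrite /ract.
by rewrite Num.Theory.oppr_le0 abszN.
Qed.

Lemma inr_sh b m : inr b m -> m = sh (~~ b) `|m|%N.
Proof. by rewrite /inr /sh; case: b => /=; lia. Qed.

Lemma Tgen_stable (S : V -> Prop) : subsp S -> stable Tgen S ->
  forall (x : Uq q s) v, S v -> S (act x v).
Proof.
move=> hS hT; apply: ract_stable => // -[[[b i] j] r] v hv.
have [i' ->] := idxP i; have [j' ->] := idxP j.
by have := hT b i' j' (sh (~~ b) r) v hv; rewrite Tgen_act.
Qed.

Definition peps (b : bool) : K := if b then -1 else 1.

Lemma parity_Tgen b i j m w :
  parity_op (Tgen b i j m w) = peps (i (+) j) *: Tgen b i j m (parity_op w).
Proof.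
have [hm|hm] := boolP (inr b m); last first.
  by rewrite !Tgen_out // scaler0 (lin0 (@parity_lin _ _ _ _ _)).
rewrite (inr_sh hm) !Tgen_act -!/(ract _ _) parity_gen /Upar.
have [c hc] := ipar_idx hs; rewrite !hc /peps.
by case: (c); case: i; case: j.
Qed.

(** A subspace stable under [parity_op] is graded: the even part of v is half of v +
    [parity_op v]. *)
Lemma irreducible_Tgen : 2%:R != 0 :> K -> irreducible V ->
  forall S, subsp S -> stable Tgen S -> (forall v, S v -> S (parity_op v)) ->
  (forall v, S v -> v = 0) \/ (forall v, S v).
Proof.
move=> two0 [_ irr] S hS hT hP; apply: irr; split=> [|a v w|x v|v hv].
- exact: hS.1.
- exact: hS.2.
- exact: Tgen_stable.
have e : ((v.1, 0) : V) = 2%:R^-1 *: (v + parity_op v).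
  apply: (scalerI two0); rewrite scalerA mulfV // scale1r scaler_nat mulr2n.
  by congr pair; rewrite /= ?addr0 ?subrr.
have h1 : S (v.1, 0) by rewrite e; apply: (subspZ hS); apply: (subspD hS) => //; exact: hP.
split=> //; have -> : ((0, v.2) : V) = v - ((v.1, 0) : V).
  by rewrite {2}[v]surjective_pairing; congr pair; rewrite /= ?subrr ?subr0.
exact: (subspB hS).
Qed.

Variables (lam lamb : 'I_2 -> nat -> K) (z : V).
Hypothesis hw : highest_weight_vector lam lamb z.

Lemma hw_12 b m : Tgen b false true m z = 0.
Proof.
have [hm|hm] := boolP (inr b m); last exact: Tgen_out.
by case: hw => _ h1 h2 _ _; rewrite (inr_sh hm) Tgen_act; case: (b); [exact: h2|exact: h1].
Qed.

Lemma hw_diag b i m :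
  Tgen b i i m z = ext b ((if b then lamb else lam) (idx i)) m *: z.
Proof.
rewrite /ext; case: ifP => hm; last by rewrite scale0r Tgen_out // hm.
rewrite {1}(inr_sh hm) Tgen_act.
by case: hw => _ _ _ h1 h2; case: (b); [exact: h2|exact: h1].
Qed.

Lemma generated_Tgen : generated_by z ->
  forall S, subsp S -> stable Tgen S -> S z -> forall v, S v.
Proof. by move=> hg S hS hT hz v; have [x ->] := hg v; exact: Tgen_stable. Qed.

End Interface.

Lemma qi_root (K : fieldType) (q : K) s : q != 0 ->
  (forall n : nat, (0 < n)%N -> q ^+ n != 1) ->
  s = [tuple false; true] \/ s = [tuple true; false] ->
  qi q s idx1 != 0 /\ forall n : nat, (0 < n)%N -> qi q s idx1 ^+ n != 1.
Proof.
move=> q0 hq [] ->; rewrite /qi /ipar (tnth_nth false) /=; split=> //.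
  by rewrite invr_eq0.
by move=> n n0; rewrite exprVn invr_eq1; exact: hq.
Qed.

Lemma expr_inj_root (K : fieldType) (p : K) : p != 0 ->
  (forall n : nat, (0 < n)%N -> p ^+ n != 1) -> injective (fun n => p ^+ n).
Proof.
move=> p0 hp i j /=; wlog ij : i j / (i <= j)%N.
  by case: (leqP i j) => [/[swap]/[apply]|/ltnW /[swap]/[apply] h e]; [apply | rewrite h].
move=> e; apply/eqP; rewrite eqn_leq ij leqNgt; apply/negP => lij.
have := hp (j - i)%N; rewrite subn_gt0 => /(_ lij)/eqP; apply.
by apply: (mulfI (expf_neq0 i p0)); rewrite -exprD subnKC // mulr1.
Qed.

(** Both sides are the coefficient of u^m in P(u), the right one through u^k (u^-k P(u)). *)
Lemma ext_at0_atoo (K : fieldType) (P : {poly K}) k m : (size P <= k.+1)%N ->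
  ext true (fps_at0 P) m = ext false (fps_atoo k P) (m - Posz k).
Proof.
move=> sP; rewrite /ext /inr /fps_at0 /fps_atoo Num.Theory.subr_le0.
have [hm|hm] := leP 0 m; last first.
  by case: ifP => // _; rewrite ifF //; apply/negP; lia.
case: leP => mk; last by rewrite nth_default //; apply: leq_trans sP _; lia.
by rewrite ifT; [congr (P`__)|]; lia.
Qed.

(** * The two implications for the highest weight representation *)

Section Equivalence.
Variables (K : fieldType) (q : K) (s : 2.-tuple bool).
Hypotheses (hq0 : q != 0) (hq : forall n : nat, (0 < n)%N -> q ^+ n != 1).
Hypothesis hs : s = [tuple false; true] \/ s = [tuple true; false].
Variables (lam lamb : 'I_2 -> nat -> K) (V : Urep q s).
Hypothesis hlam : forall i : 'I_2, lam i 0%N * lamb i 0%N = 1.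
Hypothesis hV : irreducible_highest_weight V lam lamb.

Notation p := (qi q s idx1).
Notation p' := (qi q s idx2).
Notation T := (@Tgen K q s V).

Let p0 : p != 0 := (qi_root hq0 hq hs).1.
Let hp := (qi_root hq0 hq hs).2.

Let pp' : p * p' = 1. Proof. by rewrite (qi2E q hs) mulfV. Qed.
Let pnp' : p != p'.
Proof. by have := hp (n := 2) isT; apply: contraNneq => e; rewrite expr2 {2}e pp'. Qed.
Let ppp' : p + p' != 0.
Proof.
have := hp (n := 4) isT; apply: contraNneq => /eqP; rewrite addr_eq0 => /eqP e.
have e2 : p ^+ 2 = -1 by rewrite expr2 {1}e mulNr mulrC pp'.
by rewrite (exprM p 2 2) e2 sqrrN expr1n.
Qed.

Let lam0 i : lam i 0%N != 0.
Proof. by apply/eqP => e; have /eqP := hlam i; rewrite e mul0r eq_sym oner_eq0. Qed.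
Let lamb0 i : lamb i 0%N != 0.
Proof. by apply/eqP => e; have /eqP := hlam i; rewrite e mulr0 eq_sym oner_eq0. Qed.
Let hT : rtt_sys p p' T := Tgen_sys V hs.

Lemma finite_dim_rational : (forall x : K, exists y, y * y = x) -> finite_dim V ->
  exists (k : nat) (Q Qt : {poly K}),
    [/\ size Q = k.+1 /\ size Qt = k.+1,
        lead_coef Q * Q`_0 = 1,
        lead_coef Qt * Qt`_0 = 1,
        fps_div (lam idx1) (lam idx2)
          =1 fps_div (fps_atoo k Q) (fps_atoo k Qt)
      & fps_div (fps_at0 Q) (fps_at0 Qt)
          =1 fps_div (lamb idx1) (lamb idx2)].
Proof.
move=> sqr fd; case: hV => _ [z [hw _]].
have z0 : z != 0 by case: hw.
(* Dividing by lambda_2, resp. \bar lambda_2, makes the second weight 1 and the first one the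
   quotient of the weights. *)
pose f b := fps_inv ((if b then lamb else lam) idx2).
have hT' := twist_sys hT f.
pose c b := fps_mul (f b) ((if b then lamb else lam) idx1).
have hz2 b m : twist T f b true true m z = (m == 0)%:R *: z.
  rewrite (twist_ext hT f m (hw_diag hs hw b true)).
  rewrite (ext_eq _ (a' := fun n => (n == 0%N)%:R)).
    rewrite /ext; case: ifP => [_|]; first by rewrite absz_eq0.
    by case: eqP => [->|//]; rewrite /inr lexx; case: (b).
  by move=> n; rewrite fps_mulC fps_mulV //; case: (b).
have hz1 b m : twist T f b false false m z =
    ext b (if b then c true else c false) m *: z.
  by rewrite (twist_ext hT f m (hw_diag hs hw b false)) /c; case: (b).
have [A [A0 hA]] := finite_dim_annihilates pnp' hT' z0
  (fun b => twist_12 f (hw_12 hs hw b)) hz1 hz2 fd.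
have [B [B0 hB]] := annihilates_coef0 A0 hA.
have lB : lead_coef B != 0.
  by rewrite lead_coef_eq0; apply: contraNneq B0 => ->; rewrite coef0.
(* Scaling the polynomial by [al] multiplies the product of its extreme coefficients by al^2, hence
   the square root. *)
have [al hal] := sqr (lead_coef B * B`_0)^-1.
have al2 : al * al * (lead_coef B * B`_0) = 1 by rewrite hal mulVf // mulf_neq0.
have al0 : al != 0.
  by apply/eqP => e; move: al2; rewrite e !mul0r => /eqP; rewrite eq_sym oner_eq0.
pose k := (size B).-1.
have sB : size (al *: B) = k.+1.
  by rewrite size_scale // /k prednK // lt0n size_poly_eq0 -lead_coef_eq0.
have ccb : c false 0%N * c true 0%N = 1.
  rewrite /c !fps_mul0 /f !fps_inv0 // mulrACA hlam mulr1.
  by rewrite -invfM hlam invr1.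
have nB : lead_coef (al *: B) * (al *: B)`_0 = 1.
  by rewrite lead_coefZ coefZ mulrACA.
have [sn ln e1 e2] := num_spec sB (annihilatesZ al hB) ccb nB.
exists k, (num (c true) (al *: B) k), (al *: B); split=> // n.
  by rewrite -e1 /c /f fps_mulC.
by rewrite e2 /c /f fps_mulC.
Qed.

Lemma rational_finite_dim k (Q Qt : {poly K}) : 2%:R != 0 :> K ->
  size Q = k.+1 -> size Qt = k.+1 ->
  lead_coef Q * Q`_0 = 1 -> lead_coef Qt * Qt`_0 = 1 ->
  fps_div (lam idx1) (lam idx2) =1 fps_div (fps_atoo k Q) (fps_atoo k Qt) ->
  fps_div (fps_at0 Q) (fps_at0 Qt) =1 fps_div (lamb idx1) (lamb idx2) ->
  finite_dim V.
Proof.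
move=> two0 sQ sQt lQ lQt e1 e2; case: hV => irr [z [hw hg]].
have z0 : z != 0 by case: hw.
have nz (P : {poly K}) : size P = k.+1 -> lead_coef P * P`_0 = 1 ->
    fps_atoo k P 0%N != 0 /\ fps_at0 P 0%N != 0.
  rewrite /fps_atoo /fps_at0 leq0n subn0 lead_coefE => -> /= h.
  by split; apply/eqP => e; move: h;
     rewrite e ?mul0r ?mulr0 => /eqP; rewrite eq_sym oner_eq0.
have [Qk Q0] := nz _ sQ lQ; have [Qtk Qt0] := nz _ sQt lQt.
(* This rescaling turns the weights into u^-k Q, u^-k Qt for t and Q, Qt for \bar t, so that they
   differ exactly by the factor u^k. *)
pose f b := if b then fps_div (fps_at0 Qt) (lamb idx2)
            else fps_div (fps_atoo k Qt) (lam idx2).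
pose wq (b : bool) (P : {poly K}) := if b then fps_at0 P else fps_atoo k P.
have hf b i : fps_mul (f b) ((if b then lamb else lam) (idx i)) =1
    wq b (if i then Qt else Q).
  case: b => /=.
    by have [h1 h2] := fps_div_cross (lamb0 idx2) Qt0 (fsym e2); case: i.
  by have [h1 h2] := fps_div_cross (lam0 idx2) Qtk e1; case: i.
have f0 b : f b 0%N != 0.
  by rewrite /f /fps_div; case: b; rewrite fps_mul0 fps_inv0 // mulf_neq0 // invr_eq0.
have hT' := twist_sys hT f.
pose wt b (i : bool) := ext b (wq b (if i then Qt else Q)).
have hzd b i m : twist T f b i i m z = wt b i m *: z.
  by rewrite (twist_ext hT f m (hw_diag hs hw b i)) (ext_eq _ (hf b i)).
have wt0 : wt false false 0 != 0 by [].
have hwt i m : wt true i m = wt false i (m - Posz k).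
  by rewrite /wt /wq (@ext_at0_atoo _ _ k) //; case: (i); rewrite ?sQ ?sQt.
have gen S : subsp S -> stable (twist T f) S -> S z -> forall v, S v.
  move=> hS hst; apply: (generated_Tgen hg) => //; exact: (untwist_stable hT f0 hS).
have irr' S : subsp S -> stable (twist T f) S -> (forall v, S v -> S (parity_op v)) ->
    (forall v, S v -> v = 0) \/ (forall v, S v).
  move=> hS hst; apply: (irreducible_Tgen two0 irr) => //; exact: (untwist_stable hT f0 hS).
have par_T b i j m w : parity_op (twist T f b i j m w) =
    peps K (i (+) j) *: twist T f b i j m (parity_op w).
  rewrite /twist /part (lin_sum (@parity_lin _ _ _ _ V)) scaler_sumr.
  apply: eq_bigr => r _; rewrite (linZ (@parity_lin _ _ _ _ V)) (parity_Tgen hs).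
  by rewrite !scalerA mulrC.
have peps0 b : peps K b != 0 by case: b; rewrite ?oppr_eq0 oner_eq0.
have [L hL] := span_seq pp' pnp' ppp' (expr_inj_root p0 hp) hT' (@parity_lin _ _ _ _ V)
  par_T (erefl _) peps0 irr' z0 (fun b => twist_12 f (hw_12 hs hw b)) hzd wt0 gen hwt.
exact: span_mem_finite_dim hL.
Qed.

End Equivalence.

Theorem theorem6p1 (R : realType) (q : R[i]) (hq0 : q != 0)
    (hq : forall n : nat, (0 < n)%N -> q ^+ n != 1)
    (s : 2.-tuple bool)
    (hs : s = [tuple false; true] \/ s = [tuple true; false])
    (lam lamb : 'I_2 -> nat -> R[i])
    (hlam : forall i : 'I_2, lam i 0%N * lamb i 0%N = 1)
    (V : Urep q s) (hV : irreducible_highest_weight V lam lamb) :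
  finite_dim V <->
  exists (k : nat) (Q Qt : {poly R[i]}),
    [/\ size Q = k.+1 /\ size Qt = k.+1,
        lead_coef Q * Q`_0 = 1,
        lead_coef Qt * Qt`_0 = 1,
        fps_div (lam idx1) (lam idx2)
          =1 fps_div (fps_atoo k Q) (fps_atoo k Qt)
      & fps_div (fps_at0 Q) (fps_at0 Qt)
          =1 fps_div (lamb idx1) (lamb idx2)].
Proof.
split=> [|[k [Q [Qt [[sQ sQt] lQ lQt e1 e2]]]]].
  apply: (finite_dim_rational hq0 hq hs hlam hV) => x.
  by exists (Num.Theory.sqrtC x); rewrite -expr2 Num.Theory.sqrtCK.
apply: (rational_finite_dim hq0 hq hs hlam hV _ sQ sQt lQ lQt e1 e2).
by rewrite Num.Theory.pnatr_eq0.
Qed.
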